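(* Let $(\mathcal M,\mathsf g,\mathcal E)$ be an embedded ambient structure of a Riemannian manifold $\mathcal M$. (1) There exists an $\mathcal E$-valued bilinear form $\mathcal X$ sending a pair of vector fields $(\xi,\eta)$ on $\mathcal M$ to $\mathcal X(\xi,\eta)\in\mathcal E$ such that for every vector field $\xi_0$ on $\mathcal M$ $$\langle\mathcal X(\xi,\eta),\xi_0\rangle_{\mathcal E}=\langle\xi,(\mathrm D_{\xi_0}\mathsf g)\eta\rangle_{\mathcal E}.$$ Let $\Pi_{\mathcal M,\mathsf g}$ be the $\mathsf g$-projection from $\mathcal E$ to the tangent bundle of $\mathcal M$. Then $\Pi_{\mathcal M,\mathsf g}\mathsf g^{-1}\mathcal X(\xi,\eta)$ is uniquely defined given $\xi,\eta$, and $\mathcal X(\xi,\eta)$ is itself unique if we require $\mathcal X(\xi(Y),\eta(Y))\in T_Y\mathcal M$ for all $Y\in\mathcal M$. (2) For two vector fields $\xi,\eta$ on $\mathcal M$ define $$\mathrm K(\xi,\eta):=\tfrac12\big((\mathrm D_\xi\mathsf g)\eta+(\mathrm D_\eta\mathsf g)\xi-\mathcal X(\xi,\eta)\big)\in\mathcal E,$$ $$\hat\nabla_\xi\eta:=\mathrm D_\xi\eta+\mathsf g^{-1}\mathrm K(\xi,\eta),$$ $$\nabla_\xi\eta:=\Pi_{\mathcal M,\mathsf g}\hat\nabla_\xi\eta=\Pi_{\mathcal M,\mathsf g}\big(\mathrm D_\xi\eta+\mathsf g^{-1}\mathrm K(\xi,\eta)\big).$$ Then $\nabla_\xi\eta$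 is the covariant derivative associated with the Levi-Civita connection of $\mathcal M$. It can be written as $$\nabla_\xi\eta=\mathrm D_\xi\eta+\Gamma(\xi,\eta),\qquad \Gamma(\xi,\eta):=-(\mathrm D_\xi\Pi_{\mathcal M,\mathsf g})\eta+\Pi_{\mathcal M,\mathsf g}\mathsf g^{-1}\mathrm K(\xi,\eta).$$ (3) If $\mathcal H$ is a subbundle of $T\mathcal M$ and $\xi_{\mathcal H},\eta_{\mathcal H}$ are two $\mathcal H$-valued vector fields, then $$\Pi_{\mathcal H,\mathsf g}\nabla_{\xi_{\mathcal H}}\eta_{\mathcal H}=\mathrm D_{\xi_{\mathcal H}}\eta_{\mathcal H}+\Gamma_{\mathcal H}(\xi_{\mathcal H},\eta_{\mathcal H}),\qquad \Gamma_{\mathcal H}(\xi_{\mathcal H},\eta_{\mathcal H}):=-(\mathrm D_{\xi_{\mathcal H}}\Pi_{\mathcal H,\mathsf g})\eta_{\mathcal H}+\Pi_{\mathcal H,\mathsf g}\mathsf g^{-1}\mathrm K(\xi_{\mathcal H},\eta_{\mathcal H}).$$ (4) If $f$ is a function on $\mathcal M$, $\hat f_Y$ is an ambient gradient of $f$ and $\hat f_{YY}$ is the ambient Hessian operator, then, for $\mathcal H$-valued vector fields $\xi_{\mathcal H},\eta_{\mathcal H}$, the $\mathcal H$-Riemannian Hessian operator and bilinear form are given by $$\mathsf{rhess}^{11}_{\mathcal H,f}\xi_{\mathcal H}=\Pi_{\mathcal H,\mathsf g}\mathsf g^{-1}\Big(\hat f_{YY}\xi_{\mathcal H}+\mathsf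 g\big(\mathrm D_{\xi_{\mathcal H}}(\Pi_{\mathcal H,\mathsf g}\mathsf g^{-1})\big)\hat f_Y+\mathrm K(\xi_{\mathcal H},\Pi_{\mathcal H,\mathsf g}\mathsf g^{-1}\hat f_Y)\Big)$$ $$=\Pi_{\mathcal H,\mathsf g}\mathsf g^{-1}\Big(\hat f_{YY}\xi_{\mathcal H}+\mathsf g(\mathrm D_{\xi_{\mathcal H}}\Pi_{\mathcal H,\mathsf g})\mathsf g^{-1}\hat f_Y-(\mathrm D_{\xi_{\mathcal H}}\mathsf g)\mathsf g^{-1}\hat f_Y+\mathrm K(\xi_{\mathcal H},\Pi_{\mathcal H,\mathsf g}\mathsf g^{-1}\hat f_Y)\Big),$$ $$\mathsf{rhess}^{02}_{\mathcal H,f}(\xi_{\mathcal H},\eta_{\mathcal H})=\langle\nabla_{\xi_{\mathcal H}}(\Pi_{\mathcal H,\mathsf g}\mathsf g^{-1}\hat f_Y),\mathsf g\eta_{\mathcal H}\rangle_{\mathcal E}=\hat f_{YY}(\xi_{\mathcal H},\eta_{\mathcal H})-\langle\Gamma_{\mathcal H}(\xi_{\mathcal H},\eta_{\mathcal H}),\hat f_Y\rangle_{\mathcal E}.$$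
   Context: An embedded ambient structure $(\mathcal M,\mathsf g,\mathcal E)$ consists of a finite-dimensional real inner product space $(\mathcal E,\langle,\rangle_{\mathcal E})$, a manifold $\mathcal M$ differentiably embedded in $\mathcal E$ (the embedding need not be isometric), and a smooth function $\mathsf g$ on $\mathcal M$ whose value $\mathsf g(Y)$ at $Y\in\mathcal M$ is a self-adjoint positive-definite linear operator on $\mathcal E$. Then $\mathcal M$ carries the Riemannian metric $\langle\xi,\eta\rangle_R=\langle\xi,\mathsf g(Y)\eta\rangle_{\mathcal E}$ for $\xi,\eta\in T_Y\mathcal M\subset\mathcal E$. All objects are assumed sufficiently smooth. Tangent spaces are identified with subspaces of $\mathcal E$, so vector fields are $\mathcal E$-valued functions on $\mathcal M$. For a vector field $\xi$, $\mathrm D_\xi$ denotes the directional (Lie) derivative along $\xi$, applied to scalar-, $\mathcal E$-valued or operator-valued functions on $\mathcal M$ (e.g. $\mathrm D_\xi\mathsf g$, $\mathrm D_\xi\Pi$ are operator-valued). For a subbundle $\mathcal H\subset T\mathcal M$ with fibers $\mathcal H_Y$, $\Pi_{\mathcal H,\mathsf g}$ is the operator-valued function such that $\Pi_{\mathcal H,\mathsf g}(Y):\mathcal E\to\mathcal H_Y$ is the projection with respect to $\langle\cdot,\mathsf g(Y)\cdot\rangle_{\mathcal E}$, i.e. $\langle\Pi_{\mathcal H,\mathsf g}(Y)v,\mathsf g(Y)w\rangle_{\mathcal E}=\langle v,\mathsf g(Y)w\rangle_{\mathcal E}$ for all $v\in\mathcal E$, $w\in\mathcal H_Y$. $\Pi_{\mathcal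 M,\mathsf g}:=\Pi_{T\mathcal M,\mathsf g}$. An ambient gradient of a function $f$ on $\mathcal M$ is a function $\hat f_Y:\mathcal M\to\mathcal E$ (with continuous derivatives) with $\langle\eta,\hat f_Y\rangle_{\mathcal E}=\mathrm D_\eta f$ for all vector fields $\eta$ on $\mathcal M$ (for example the restriction to $\mathcal M$ of the gradient of an extension of $f$ to a neighborhood in $\mathcal E$). The ambient Hessian operator is $\hat f_{YY}\xi:=\mathrm D_\xi\hat f_Y$, and the ambient Hessian bilinear form is $\hat f_{YY}(\xi,\eta):=\langle\mathrm D_\xi\hat f_Y,\eta\rangle_{\mathcal E}$. The $\mathcal H$-Riemannian gradient $\mathsf{rgrad}_{\mathcal H,f}$ is the unique $\mathcal H$-valued vector field with $\langle\mathsf{rgrad}_{\mathcal H,f},\xi_{\mathcal H}\rangle_R=\mathrm D_{\xi_{\mathcal H}}f$ for all $\mathcal H$-valued vector fields $\xi_{\mathcal H}$; it equals $\Pi_{\mathcal H,\mathsf g}\mathsf g^{-1}\hat f_Y$. With $\nabla$ the Levi-Civita connection, $\mathsf{rhess}^{11}_{\mathcal H,f}\xi_{\mathcal H}:=\Pi_{\mathcal H,\mathsf g}\nabla_{\xi_{\mathcal H}}\mathsf{rgrad}_{\mathcal H,f}$ and $\mathsf{rhess}^{02}_{\mathcal H,f}(\xi_{\mathcal H},\eta_{\mathcal H}):=\langle\nabla_{\xi_{\mathcal H}}\mathsf{rgrad}_{\mathcal H,f},\eta_{\mathcal H}\rangle_R$. *)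

(* Defs.v *)
From HB Require Import structures.
From mathcomp Require Import all_boot all_order all_algebra.
From mathcomp Require Import all_classical all_reals all_analysis.

Set Implicit Arguments.
Unset Strict Implicit.
Unset Printing Implicit Defensive.

Import Order.TTheory GRing.Theory Num.Theory.
Import numFieldNormedType.Exports.

Local Open Scope ring_scope.
Local Open Scope classical_set_scope.

#[short(type="normedVectType")]
HB.structure Definition NormedVector (R : realType) :=
  {E of Vector R E & NormedModule R E}.

(* The induction on directional derivatives along fixed vectors is the usual
   C^k condition because it is only used with a finite-dimensional [V]. *)
Fixpoint Ck (R : realType) (V W : normedModType R) (k : nat)
    (U : set V) (F : V -> W) : Prop :=
  if k is k'.+1 then
    (forall x, U x -> differentiable F x) /\
    (forall v : V, Ck k' U (fun x => 'D_v F x))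
  else forall x, U x -> {for x, continuous F}.

Definition Cinf (R : realType) (V W : normedModType R)
    (U : set V) (F : V -> W) : Prop := forall k, Ck k U F.

(* Functions on a subset [A] of [V] are represented by total functions whose
   values outside [A] are irrelevant: [F] has regularity [P] on [A] when, near
   each point of [A], it agrees on [A] with a function of regularity [P]
   defined on an open subset of [V]. *)
Definition locally_extends (R : realType) (V W : normedModType R)
    (P : set V -> (V -> W) -> Prop) (A : set V) (F : V -> W) : Prop :=
  forall Y, A Y -> exists (U : set V) (G : V -> W),
    [/\ open U, U Y, P U G & forall Z, U Z -> A Z -> G Z = F Z].

Definition C1_on (R : realType) (V W : normedModType R) :=
  @locally_extends R V W (Ck 1).

Definition smooth_on (R : realType) (V W : normedModType R) :=
  @locally_extends R V W (@Cinf R V W).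

Section EmbeddedManifold.
Context (R : realType) (E : normedVectType R).
Implicit Types (M : set E) (Y : E).

(* Every point of [M] has a neighborhood in [M] diffeomorphic to an open
   subset of R^d: [psi] is the parametrization, [phi] the chart. *)
Definition submanifold (d : nat) M : Prop :=
  forall Y, M Y ->
  exists (U : set E) (V : set 'rV[R]_d) (phi : E -> 'rV[R]_d)
         (psi : 'rV[R]_d -> E),
    [/\ open U, U Y & open V] /\
    [/\ Cinf U phi, Cinf V psi,
        (forall Z, M Z -> U Z -> V (phi Z) /\ psi (phi Z) = Z) &
        (forall x, V x -> [/\ M (psi x), U (psi x) & phi (psi x) = x])].

Definition curve_through M Y (v : E) (c : R -> E) : Prop :=
  [/\ c 0 = Y, is_derive (0 : R) 1 c v &
      exists2 e : R, 0 < e &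
        Cinf (ball (0 : R) e) c /\ (forall t, ball (0 : R) e t -> M (c t))].

Definition tangent M Y : set E :=
  [set v | exists c, curve_through M Y v c].

(* The derivative (F o c)'(0) for a curve [c] in [M] with c(0) = Y and
   c'(0) = v.  For differentiable [F] it does not depend on [c]; the default
   value 0 is only used when no such derivative exists. *)
Definition Dalong M (W : normedModType R) (F : E -> W) Y (v : E) : W :=
  xget 0 [set w | exists2 c, curve_through M Y v c &
                             is_derive (0 : R) 1 (F \o c) w].

(* The derivative of an operator-valued function, computed pointwise on the
   argument [u], which is kept fixed. *)
Definition Dop M (T : E -> 'End(E)) Y (v u : E) : E :=
  Dalong M (fun Z => T Z u) Y v.

(* For a family [H] of subspaces; vector fields are the case H = TM. *)
Definition is_section M (H : E -> set E) (xi : E -> E) : Prop :=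
  smooth_on M xi /\ (forall Y, M Y -> H Y (xi Y)).

Definition vector_field M := is_section M (tangent M).

Definition subbundle M (H : E -> set E) : Prop :=
  (forall Y, M Y -> H Y `<=` tangent M Y) /\
  exists r : nat, forall Y, M Y ->
    exists (U : set E) (e : 'I_r -> E -> E),
      [/\ open U, U Y, (forall i, smooth_on (M `&` U) (e i)) &
          forall Z, M Z -> U Z ->
            let s := [tuple e i Z | i < r] in
            free s /\ H Z = [set v | v \in << s >>%VS]].

Context (ip : {dot E for idfun}).
Implicit Types (g : E -> 'End(E)) (H : E -> set E) (xi eta : E -> E).

(* Since [E] is finite-dimensional, [g] is smooth as an operator-valued function
   exactly when each [Y |-> g Y u] is smooth. *)
Record ambient_structure (d : nat) M g : Prop := {
  ambient_norm : forall x : E, `|x| ^+ 2 = ip x x ;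
  ambient_manifold : submanifold d M ;
  ambient_smooth : forall u : E, smooth_on M (fun Y => g Y u) ;
  ambient_selfadjoint :
    forall Y, M Y -> forall u v : E, ip (g Y u) v = ip u (g Y v) ;
  ambient_posdef :
    forall Y, M Y -> forall u : E, u != 0 -> 0 < ip u (g Y u)
}.

Definition ginv g Y : 'End(E) := ((g Y)^-1)%VF.

Definition rmetric g Y (u v : E) : R := ip u (g Y v).

Definition gproj g H Y : 'End(E) :=
  xget 0 [set P : 'End(E) |
    (forall v, H Y (P v)) /\
    (forall v w, H Y w -> ip (P v) (g Y w) = ip v (g Y w))].

(* Connections act on representatives of vector fields, hence the field
   [conn_ext]. *)
Record affine_connection M (nabla : (E -> E) -> (E -> E) -> E -> E) : Prop := {
  conn_field : forall xi eta, vector_field M xi -> vector_field M eta ->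
    vector_field M (nabla xi eta) ;
  conn_ext : forall xi xi' eta eta',
    vector_field M xi -> vector_field M xi' ->
    vector_field M eta -> vector_field M eta' ->
    (forall Y, M Y -> xi Y = xi' Y) -> (forall Y, M Y -> eta Y = eta' Y) ->
    forall Y, M Y -> nabla xi eta Y = nabla xi' eta' Y ;
  conn_linear : forall (a : E -> R) xi xi' eta, smooth_on M a ->
    vector_field M xi -> vector_field M xi' -> vector_field M eta ->
    forall Y, M Y ->
    nabla (fun Z => a Z *: xi Z + xi' Z) eta Y =
      a Y *: nabla xi eta Y + nabla xi' eta Y ;
  conn_additive : forall xi eta eta',
    vector_field M xi -> vector_field M eta -> vector_field M eta' ->
    forall Y, M Y ->
    nabla xi (fun Z => eta Z + eta' Z) Y = nabla xi eta Y + nabla xi eta' Y ;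
  conn_leibniz : forall (a : E -> R) xi eta, smooth_on M a ->
    vector_field M xi -> vector_field M eta ->
    forall Y, M Y ->
    nabla xi (fun Z => a Z *: eta Z) Y =
      Dalong M a Y (xi Y) *: eta Y + a Y *: nabla xi eta Y
}.

Definition torsion_free M (nabla : (E -> E) -> (E -> E) -> E -> E) : Prop :=
  forall xi eta (a : E -> R),
    vector_field M xi -> vector_field M eta -> smooth_on M a ->
    forall Y, M Y ->
    Dalong M a Y (nabla xi eta Y - nabla eta xi Y) =
      Dalong M (fun Z => Dalong M a Z (eta Z)) Y (xi Y) -
      Dalong M (fun Z => Dalong M a Z (xi Z)) Y (eta Y).

Definition metric_compatible M g
    (nabla : (E -> E) -> (E -> E) -> E -> E) : Prop :=
  forall zeta xi eta,
    vector_field M zeta -> vector_field M xi -> vector_field M eta ->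
    forall Y, M Y ->
    Dalong M (fun Z => rmetric g Z (xi Z) (eta Z) : R) Y (zeta Y) =
      rmetric g Y (nabla zeta xi Y) (eta Y) +
      rmetric g Y (xi Y) (nabla zeta eta Y).

Definition levi_civita M g (nabla : (E -> E) -> (E -> E) -> E -> E) : Prop :=
  [/\ affine_connection M nabla, torsion_free M nabla &
      metric_compatible M g nabla].

(* [X Y] is the E-valued bilinear form on T_Y M; on vector fields it takes the
   value [X Y (xi Y) (eta Y)] at [Y]. *)
Record ambient_form M g (X : E -> E -> E -> E) : Prop := {
  form_linearl : forall Y, M Y -> forall (a : R) (u u' v : E),
    tangent M Y u -> tangent M Y u' -> tangent M Y v ->
    X Y (a *: u + u') v = a *: X Y u v + X Y u' v ;
  form_linearr : forall Y, M Y -> forall (a : R) (u v v' : E),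
    tangent M Y u -> tangent M Y v -> tangent M Y v' ->
    X Y u (a *: v + v') = a *: X Y u v + X Y u v' ;
  form_adjoint : forall xi eta xi0,
    vector_field M xi -> vector_field M eta -> vector_field M xi0 ->
    forall Y, M Y ->
    ip (X Y (xi Y) (eta Y)) (xi0 Y) = ip (xi Y) (Dop M g Y (xi0 Y) (eta Y))
}.

Definition tangent_valued M (X : E -> E -> E -> E) : Prop :=
  forall xi eta, vector_field M xi -> vector_field M eta ->
  forall Y, M Y -> tangent M Y (X Y (xi Y) (eta Y)).

Definition Kform M g (X : E -> E -> E -> E) xi eta Y : E :=
  2^-1 *: (Dop M g Y (xi Y) (eta Y) + Dop M g Y (eta Y) (xi Y)
           - X Y (xi Y) (eta Y)).

Definition hat_nabla M g X xi eta Y : E :=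
  Dalong M eta Y (xi Y) + ginv g Y (Kform M g X xi eta Y).

Definition ambient_nabla M g X xi eta Y : E :=
  gproj g (tangent M) Y (hat_nabla M g X xi eta Y).

Definition Gamma M g X H xi eta Y : E :=
  - Dop M (gproj g H) Y (xi Y) (eta Y)
  + gproj g H Y (ginv g Y (Kform M g X xi eta Y)).

Definition ambient_gradient M (f : E -> R) (fhat : E -> E) : Prop :=
  C1_on M fhat /\
  (forall eta, vector_field M eta -> forall Y, M Y ->
    ip (eta Y) (fhat Y) = Dalong M f Y (eta Y)).

Definition ambient_hess M (fhat xi : E -> E) Y : E := Dalong M fhat Y (xi Y).

Definition rgrad M g H (f : E -> R) : E -> E :=
  xget (fun=> 0) [set G : E -> E | is_section M H G /\
    forall xi, is_section M H xi -> forall Y, M Y ->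
      rmetric g Y (G Y) (xi Y) = Dalong M f Y (xi Y)].

Definition rhess11 M g (nabla : (E -> E) -> (E -> E) -> E -> E) H (f : E -> R)
    xi Y : E :=
  gproj g H Y (nabla xi (rgrad M g H f) Y).

Definition rhess02 M g (nabla : (E -> E) -> (E -> E) -> E -> E) H (f : E -> R)
    xi eta Y : R :=
  rmetric g Y (nabla xi (rgrad M g H f) Y) (eta Y).

End EmbeddedManifold.

(* Main.v *)
(* Near each of its points, M is the image of a smooth idempotent map r of an
   open subset of E (a parametrization composed with its chart).  Hence T_Y M is
   the fixed space of dr_Y, the derivative along M of F at Y is d(F o r)_Y, and
   smoothness of F on M is smoothness of F o r, so that calculus on M reduces to
   calculus in E.

   Projections onto a bundle with a smooth local frame are obtained by
   Gram-Schmidt orthogonalization of the frame, which only needs inverses of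
   scalar functions and thus shows that Pi_{H,g} and g^-1 are smooth.

   All statements about nabla are read off from its pairing with tangent
   vectors, where X has been eliminated: for w in T_Y M,
     <nabla_xi eta, g w> = <D_xi eta, g w> + koszul(xi, eta, w).
   Torsion-freeness rests on the symmetry of second derivatives: differentiating
   dr(eta) = eta along xi and antisymmetrizing shows that D_xi eta - D_eta xi is
   tangent.  The formulas for the Hessian then follow by the Leibniz rule and, for
   the bilinear form, by metric compatibility applied to <grad, g eta> =
   <fhat, eta>. *)
Require Import Defs.
From HB Require Import structures.
From mathcomp Require Import all_boot all_order all_algebra.
From mathcomp Require Import all_classical all_reals all_analysis.
From mathcomp Require Import ring lra.

Set Implicit Arguments.
Unset Strict Implicit.
Unset Printing Implicit Defensive.

Import Order.TTheory GRing.Theory Num.Theory.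
Import numFieldNormedType.Exports.

Local Open Scope ring_scope.
Local Open Scope classical_set_scope.


(** * Calculus of C^k maps *)

(** Three features of the definitions shape the proof. [Dalong] is a choice over curves, so its
    rules carry the hypothesis [dif_at], that a differentiable extension exists. [ambient_form] asks
    no smoothness of [X], whose normal component is arbitrary; smoothness of nabla is therefore
    shown for one particular smooth [X] and transferred, nabla being independent of [X] on [M].
    Finally [fhat] is only C^1, while the gradient must be a smooth section: the Gram-Schmidt step
    is stated so that only the pairings of [fhat] with sections have to be smooth, and these are
    derivatives of the smooth [f]. As [rgrad] is a choice among functions that agree on [M] only,
    [conn_ext] is what lets nabla be applied to it. *)

Section Calculus.
Context {R : realType}.
Implicit Types V W : normedModType R.

Lemma scale_is_bilinear W :
  bilinear_for
    (GRing.Scale.Law.clone _ _ *:%R _) (GRing.Scale.Law.clone _ _ *:%R _)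
    (@GRing.scale R W : R -> W -> W).
Proof.
split=> [u'|u] a x y /=; first by rewrite scalerDl scalerA.
by rewrite scalerDr !scalerA mulrC.
Qed.

(** The product rule, read off from the differential of the continuous bilinear map [*:] composed
    with the pair [(a, F)]. *)
Lemma is_diff_scale V W (a : V -> R) (F : V -> W) x :
  differentiable a x -> differentiable F x ->
  is_diff x (fun z => a z *: F z) (fun v => 'd a x v *: F x + a x *: 'd F x v).
Proof.
move=> da dF.
pose bM := bilinear_isBilinear.Build R R W W _ _ _ (@scale_is_bilinear W).
pose b : {bilinear R -> W -> W} := HB.pack (@GRing.scale R W : R -> W -> W) bM.
have cb : continuous (fun p : R * W => b p.1 p.2) by exact: scale_continuous.
have dB p := differentiable_bilin p cb.
have dp := differentiable_pair da dF.
have -> : (fun z => a z *: F z) =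
  (fun p : R * W => b p.1 p.2) \o (fun z => (a z, F z)) by [].
split; first exact: differentiable_comp.
rewrite diff_comp // diff_bilin // diff_pair //.
by apply/funext => v /=; rewrite addrC.
Qed.

Lemma derive_scale V W (a : V -> R) (F : V -> W) x v :
  differentiable a x -> differentiable F x ->
  'D_v (fun z => a z *: F z) x = 'D_v a x *: F x + a x *: 'D_v F x.
Proof.
move=> da dF; have [dB BE] := is_diff_scale da dF.
by rewrite !deriveE // BE.
Qed.

Lemma differentiable_scale V W (a : V -> R) (F : V -> W) x :
  differentiable a x -> differentiable F x ->
  differentiable (fun z => a z *: F z) x.
Proof. by move=> da dF; have [] := is_diff_scale da dF. Qed.

Lemma derive_comp V V' W (F : V' -> W) (G : V -> V') x v :
  differentiable G x -> differentiable F (G x) ->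
  'D_v (F \o G) x = 'D_('D_v G x) F (G x).
Proof.
move=> dG dF; rewrite !deriveE //; last exact: differentiable_comp.
by rewrite diff_comp.
Qed.

Lemma derive_lin V W (L : {linear V -> W}) x v :
  continuous L -> 'D_v L x = L v.
Proof. by move=> cL; rewrite deriveE ?diff_lin //; exact: linear_differentiable. Qed.

Lemma derive_linear_comp V V' W (L : {linear V' -> W}) (G : V -> V') x v :
  continuous L -> differentiable G x -> 'D_v (fun z => L (G z)) x = L ('D_v G x).
Proof.
move=> cL dG; have dL := linear_differentiable (G x) cL.
by rewrite -[LHS]/('D_v (L \o G) x) derive_comp // derive_lin.
Qed.

Lemma Ck_sub V W k (U U' : set V) (F : V -> W) :
  U' `<=` U -> Ck k U F -> Ck k U' F.
Proof.
move=> sU; elim: k F => [F cF x /sU/cF //|k IH F [dF CF]].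
by split=> [x /sU/dF //|v]; exact: IH (CF v).
Qed.

Lemma Ck_diff V W k (U : set V) (F : V -> W) x :
  Ck k.+1 U F -> U x -> differentiable F x.
Proof. by case=> dF _; exact: dF. Qed.

Lemma CkS V W k (U : set V) (F : V -> W) : Ck k.+1 U F -> Ck k U F.
Proof.
elim: k F => [F [dF _] x /dF/differentiable_continuous //|k IH F [dF CF]].
by split=> // v; exact: IH (CF v).
Qed.

Lemma open_near V (U : set V) x (P : V -> Prop) : open U -> U x ->
  (forall y, U y -> P y) -> \forall y \near x, P y.
Proof.
by move=> oU Ux UP; move: (open_nbhs_nbhs (conj oU Ux)); apply: filterS.
Qed.

(** Near [x] the first-order expansion of [F] is one of [G], and such an expansion determines the
    differential. *)
Lemma diff_eq_open V W (U : set V) (F G : V -> W) x : open U -> U x ->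
  (forall y, U y -> F y = G y) -> differentiable F x -> differentiable G x.
Proof.
move=> oU Ux FG dF; apply/diff_locallyP.
have nFG : \forall y \near 0, F (y + x) = G (y + x).
  have : \forall y \near x, F y = G y by exact: open_near FG.
  by rewrite (near_shift 0) /=; apply: filterS => y /=; rewrite subr0.
have GE : G \o shift x = cst (G x) + 'd F x +o_ 0 id.
  apply/eqaddoP => e e0; have /diff_locallyP[_ /eqaddoP/(_ e e0)] := dF.
  apply: filter_app; near=> y.
  have FGy : F (y + x) = G (y + x) by near: y.
  rewrite -[(F \o shift x - _) y]/(F (y + x) - (F x + 'd F x y)).
  rewrite -[(G \o shift x - _) y]/(G (y + x) - (G x + 'd F x y)).
  by rewrite FGy (FG x Ux).
have dGE : 'd G x = 'd F x :> (V -> W).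
  by apply: diff_unique => //; exact: diff_continuous.
by rewrite dGE; split=> //; exact: diff_continuous.
Unshelve. all: by end_near. Qed.

Lemma derive_eq_open V W (U : set V) (F G : V -> W) x v : open U -> U x ->
  (forall y, U y -> F y = G y) -> 'D_v F x = 'D_v G x.
Proof. by move=> oU Ux FG; apply: near_eq_derive; exact: open_near FG. Qed.

(** Lets the closure lemmas below replace a derivative by its product or chain rule formula, which
    is valid on [U] only. *)
Lemma Ck_eq V W k (U : set V) (F G : V -> W) : open U ->
  (forall y, U y -> F y = G y) -> Ck k U F -> Ck k U G.
Proof.
move=> oU; elim: k F G => [F G FG CF x Ux|k IH F G FG [dF CF]].
  have := CF x Ux; rewrite /prop_for /continuous_at -(FG x Ux) => cF.
  apply: cvg_trans cF; apply: near_eq_cvg.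
  exact: open_near FG.
split=> [x Ux|v]; first exact: (diff_eq_open oU Ux FG (dF x Ux)).
apply: IH (CF v) => x Ux; exact: derive_eq_open FG.
Qed.

Lemma Ck_cst V W k (U : set V) (w : W) : Ck k U (fun=> w).
Proof.
elim: k w => [w x _|k IH w]; first exact: cvg_cst.
split=> [x _|v]; first exact: differentiable_cst.
have -> : (fun x : V => 'D_v (fun=> w) x) = (fun=> 0).
  by apply/funext => x; rewrite derive_cst.
exact: IH.
Qed.

Lemma Ck_lin V W k (U : set V) (L : {linear V -> W}) :
  continuous L -> Ck k U L.
Proof.
move=> cL; case: k => [x _|k]; first exact: cL.
split=> [x _|v]; first exact: linear_differentiable.
have -> : (fun x : V => 'D_v L x) = (fun=> L v).
  by apply/funext => x; rewrite derive_lin.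
exact: Ck_cst.
Qed.

Lemma CkD V W k (U : set V) (F G : V -> W) : open U ->
  Ck k U F -> Ck k U G -> Ck k U (fun x => F x + G x).
Proof.
move=> oU; elim: k F G => [F G cF cG x Ux|k IH F G [dF CF] [dG CG]].
  by apply: cvgD; [exact: cF|exact: cG].
split=> [x Ux|v]; first by apply: differentiableD; [exact: dF|exact: dG].
apply: Ck_eq oU _ (IH _ _ (CF v) (CG v)) => x Ux.
by rewrite -deriveD //; apply: diff_derivable; [exact: dF|exact: dG].
Qed.

Lemma CkZ V W k (U : set V) (a : V -> R) (F : V -> W) : open U ->
  Ck k U a -> Ck k U F -> Ck k U (fun x => a x *: F x).
Proof.
move=> oU; elim: k a F => [F G cF cG x Ux|k IH a F Ca CF].
  by apply: cvgZ; [exact: cF|exact: cG].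
move: (Ca) (CF) => [da Da] [dF DF].
split=> [x Ux|v]; first by apply: differentiable_scale; [exact: da|exact: dF].
apply: Ck_eq oU _ (CkD oU (IH _ _ (Da v) (CkS CF)) (IH _ _ (CkS Ca) (DF v))).
by move=> x Ux; rewrite derive_scale //; [exact: da|exact: dF].
Qed.

Lemma Ck_linear V V' W k (U : set V) (L : {linear V' -> W}) (F : V -> V') :
  open U -> continuous L -> Ck k U F -> Ck k U (fun x => L (F x)).
Proof.
move=> oU cL; elim: k F => [F cF x Ux|k IH F [dF DF]].
  by apply: (cvg_comp F L); [exact: cF|exact: cL].
split=> [x Ux|v].
  apply: (@differentiable_comp _ _ _ _ F L); first exact: dF.
  exact: linear_differentiable.
apply: Ck_eq oU _ (IH _ (DF v)) => x Ux.
by rewrite derive_linear_comp //; exact: dF.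
Qed.

Lemma Ck_sum V W k (U : set V) n (F : 'I_n -> V -> W) : open U ->
  (forall i, Ck k U (F i)) -> Ck k U (fun x => \sum_i F i x).
Proof.
move=> oU; elim: n F => [F CF|n IH F CF].
  apply: Ck_eq oU _ (Ck_cst k U 0) => x _; by rewrite big_ord0.
apply: Ck_eq oU _ (CkD oU (IH (fun i => F (widen_ord (leqnSn n) i)) _) (CF ord_max)).
- by move=> x _; rewrite big_ord_recr.
- by move=> i; exact: CF.
Qed.

Lemma CkV V k (U : set V) (a : V -> R) : open U ->
  (forall x, U x -> a x != 0) -> Ck k U a -> Ck k U (fun x => (a x)^-1).
Proof.
move=> oU a0; elim: k => [cF x Ux|k IH Ca].
  by apply: cvgV; [exact: a0|exact: cF].
have [da Da] := Ca.
split=> [x Ux|v].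
  apply: (@differentiable_comp _ _ _ _ a (@GRing.inv R)); first exact: da.
  by apply: differentiable_Rinv; exact: a0.
have Cb : Ck k U (fun x => (a x)^-1) by exact/IH/CkS.
(* The derivative of [1/a] is [-(1/a)^2 a'], where [1/a] is already C^k by induction. *)
apply: Ck_eq oU _ (CkZ oU (Ck_cst k U (-1 : R)) (CkZ oU Cb (CkZ oU Cb (Da v)))).
move=> x Ux /=.
have dax : derivable a x v by exact/diff_derivable/da.
rewrite deriveV //; last exact: a0.
by rewrite /GRing.scale /= mulN1r expr2 invfM mulNr mulrA.
Qed.

(* Linear, continuous coordinates; lets [Ck] be tested along finitely many
   fixed directions in the chain rule. *)
Definition has_coordinates V := exists n (b : 'I_n -> V)
  (c : 'I_n -> {linear V -> R}), (forall i, continuous (c i)) /\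
  forall v, v = \sum_i c i v *: b i.

Lemma Ck_comp V V' W k (U : set V) (U' : set V') (F : V' -> W) (G : V -> V') :
  has_coordinates V' -> open U -> (forall x, U x -> U' (G x)) ->
  Ck k U G -> Ck k U' F -> Ck k U (fun x => F (G x)).
Proof.
move=> [n [b [c [cc bc]]]] oU GU; elim: k F => [F CG CF x Ux|k IH F CG CF].
  by apply: (cvg_comp G F); [exact: CG|exact/CF/GU].
have [dG DG] := CG; have [dF DF] := CF.
split=> [x Ux|v].
  by apply: (@differentiable_comp _ _ _ _ G F); [exact: dG|exact/dF/GU].
(* The direction ['D_v G x] moves with [x]; linearity of the differential of [F] splits it over the
   fixed directions [b i]. *)
have CD i : Ck k U (fun x => c i ('D_v G x) *: 'D_(b i) F (G x)).
  apply: CkZ => //; first exact: Ck_linear oU (cc i) (DG v).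
  exact: IH (fun y => 'D_(b i) F y) (CkS CG) (DF (b i)).
apply: Ck_eq oU _ (Ck_sum oU CD) => x Ux.
have dFx : differentiable F (G x) by exact/dF/GU.
rewrite -[RHS]/('D_v (F \o G) x) (derive_comp v (dG x Ux) dFx).
rewrite [in RHS]deriveE // [in RHS](bc ('D_v G x)) linear_sum.
by apply: eq_bigr => i _; rewrite linearZ (@deriveE _ _ _ F _ (b i) dFx).
Qed.

End Calculus.

(** * Symmetry of second derivatives *)

Section Schwarz.
Context {R : realType}.
Implicit Types V W : normedModType R.

Lemma line_differentiable V (y u : V) (s : R) :
  differentiable (fun t : R => y + t *: u) s.
Proof. by apply: differentiableD => //; exact: differentiableZl. Qed.

Lemma derive_line V (y u : V) (s : R) : 'D_1 (fun t : R => y + t *: u) s = u.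
Proof.
rewrite deriveD; last by apply: diff_derivable; exact: differentiableZl.
  rewrite derive_cst add0r deriveE; last exact: differentiableZl.
  by rewrite diff_val scale1r.
exact: derivable_cst.
Qed.

Lemma is_derive_line V W (F : V -> W) (y u : V) (s : R) :
  differentiable F (y + s *: u) ->
  is_derive s 1 (fun t : R => F (y + t *: u)) ('D_u F (y + s *: u)).
Proof.
move=> dF; have dl := line_differentiable y u s.
have E := derive_comp (1 : R) dl dF; rewrite derive_line in E; rewrite -E.
apply: derivableP; apply: diff_derivable.
exact: (@differentiable_comp _ _ _ _ (fun t : R => y + t *: u) F).
Qed.

Lemma MVT_diff (p : R -> R) (dp : R -> R) (h : R) : 0 < h ->
  (forall s, 0 <= s <= h -> is_derive s 1 p (dp s)) ->
  exists2 s, 0 <= s <= h & p h - p 0 = h * dp s.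
Proof.
move=> h0 Dp; have [||s] := @MVT R p dp 0 h h0.
- by move=> s; rewrite in_itv /= => /andP[s0 sh]; apply: Dp; rewrite !ltW.
- apply: derivable_within_continuous => s; rewrite in_itv /= => sh.
  by have [] := Dp s sh.
by rewrite in_itv /= subr0 mulrC => /andP[s0 sh] ->; exists s => //; rewrite !ltW.
Qed.

(** The mean value theorem is applied twice: along [u] to the increment of [f] in direction [h v],
    then along [v] to [p]. *)
Lemma second_difference V (f p q : V -> R) (U : set V) (x u v : V) (h : R) :
  0 < h ->
  (forall z, U z -> differentiable f z /\ 'D_u f z = p z) ->
  (forall z, U z -> differentiable p z /\ 'D_v p z = q z) ->
  (forall s t, 0 <= s <= h -> 0 <= t <= h -> U (x + s *: u + t *: v)) ->
  exists s t, [/\ 0 <= s <= h, 0 <= t <= h &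
    f (x + h *: u + h *: v) - f (x + h *: u) - f (x + h *: v) + f x =
    h * (h * q (x + s *: u + t *: v))].
Proof.
move=> h0 df dp Uh.
have hh : 0 <= h <= h by rewrite lexx ltW.
have h00 : 0 <= (0 : R) <= h by rewrite lexx ltW.
have D1 z s : U (z + s *: u) ->
    is_derive s 1 (fun t : R => f (z + t *: u)) (p (z + s *: u)).
  by move=> /df[dfz <-]; exact: is_derive_line.
have D2 z s : U (z + s *: v) ->
    is_derive s 1 (fun t : R => p (z + t *: v)) (q (z + s *: v)).
  by move=> /dp[dpz <-]; exact: is_derive_line.
have D3 s : 0 <= s <= h ->
    is_derive s 1 (fun s => f (x + h *: v + s *: u) - f (x + s *: u))
      (p (x + h *: v + s *: u) - p (x + s *: u)).
  move=> sh; apply: is_deriveB; apply: D1; first by rewrite addrAC; exact: Uh.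
  by have := Uh s 0 sh h00; rewrite scale0r addr0.
have [s sh E1] := MVT_diff h0 D3.
have D4 t : 0 <= t <= h ->
    is_derive t 1 (fun t => p (x + s *: u + t *: v)) (q (x + s *: u + t *: v)).
  by move=> th; apply: D2; exact: Uh.
have [t th E2] := MVT_diff h0 D4.
exists s, t; split=> //; rewrite -E2 scale0r addr0 [x + s *: u + h *: v]addrAC -E1.
by rewrite !scale0r !addr0 [x + h *: v + h *: u]addrAC opprB addrA addrAC.
Qed.

Lemma near_parallelogram V (u v x : V) (P : V -> Prop) :
  (\forall z \near x, P z) -> exists2 h : R, 0 < h &
  forall s t, 0 <= s <= h -> 0 <= t <= h -> P (x + s *: u + t *: v).
Proof.
move=> /nbhs_ballP[_ /posnumP[e] eP].
(* Then [h (|u| + |v| + 1) = e / 2]; the summand 1 keeps the denominator positive when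
   [u = v = 0]. *)
pose h := e%:num / (2 * (`|u| + `|v| + 1)).
have uv0 : 0 < `|u| + `|v| + 1 by rewrite ltr_wpDl // addr_ge0.
have h0 : 0 < h by rewrite divr_gt0 // mulr_gt0.
exists h => // s t /andP[s0 sh] /andP[t0 th]; apply: eP.
rewrite -ball_normE /= -addrA opprD addrA subrr add0r normrN.
apply: le_lt_trans (ler_normD _ _) _; rewrite !normrZ !ger0_norm //.
apply: (@le_lt_trans _ _ (h * (`|u| + `|v|))).
  by rewrite mulrDr lerD // ler_wpM2r.
apply: (@lt_le_trans _ _ (h * (`|u| + `|v| + 1))).
  by rewrite ltr_pM2l // ltrDl.
rewrite /h invfM mulrA mulrVK ?unitfE ?gt_eqF //.
by rewrite ler_pdivrMr // ler_peMr // ler1n.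
Qed.

(** The second difference of [f] does not change when [u] and [v] are swapped. Divided by [h^2], it
    is a value of [q] and a value of [q'] at two points close to [x], so by continuity [q x] and
    [q' x] cannot differ. *)
Lemma mixed_derivatives_eq V (f p p' q q' : V -> R) (U : set V) (x u v : V) :
  open U -> U x ->
  (forall z, U z -> differentiable f z /\ 'D_u f z = p z) ->
  (forall z, U z -> differentiable f z /\ 'D_v f z = p' z) ->
  (forall z, U z -> differentiable p z /\ 'D_v p z = q z) ->
  (forall z, U z -> differentiable p' z /\ 'D_u p' z = q' z) ->
  {for x, continuous q} -> {for x, continuous q'} -> q x = q' x.
Proof.
move=> oU Ux df df' dp dp' ca cb; apply/eqP/negPn/negP => ab.
pose e := `|q x - q' x| / 2.
have e0 : 0 < e by rewrite divr_gt0 // normr_gt0 subr_eq0.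
have na : \forall z \near x, `|q x - q z| < e.
  exact: (cvgrPdist_lt _ _).1 ca e e0.
have nb : \forall z \near x, `|q' x - q' z| < e.
  exact: (cvgrPdist_lt _ _).1 cb e e0.
have nU := open_near oU Ux (fun y Uy => Uy).
have [h h0 hP] := near_parallelogram u v (filterI na (filterI nb nU)).
have [s [t [sh th E1]]] := second_difference h0 df dp
  (fun s t sh th => (hP s t sh th).2.2).
have hP' s' t' : 0 <= s' <= h -> 0 <= t' <= h -> U (x + s' *: v + t' *: u).
  by move=> sh' th'; rewrite addrAC; exact: (hP t' s' th' sh').2.2.
have [t' [s' [th' sh' E2]]] := second_difference h0 df' dp' hP'.
have EE : q (x + s *: u + t *: v) = q' (x + t' *: v + s' *: u).
  apply: (mulfI (lt0r_neq0 h0)); apply: (mulfI (lt0r_neq0 h0)).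
  by rewrite -E1 -E2 [x + h *: v + h *: u]addrAC; congr (_ + _); exact: addrAC.
have [A _] := hP s t sh th; have [_ [B _]] := hP s' t' sh' th'.
move: A B; rewrite /= EE [x + s' *: u + _]addrAC.
set c := q' (x + _ + _) => A B.
have : `|q x - q' x| < e + e.
  apply: le_lt_trans (ler_distD c _ _) _.
  by apply: ltrD => //; rewrite distrC.
by rewrite /e -splitr ltxx.
Qed.

Lemma schwarz V (f : V -> R) (U : set V) (x u v : V) : open U -> U x ->
  Ck 2 U f ->
  'D_v (fun z => 'D_u f z) x = 'D_u (fun z => 'D_v f z) x.
Proof.
move=> oU Ux [df Df].
have [dDu /(_ v) cDu] := Df u; have [dDv /(_ u) cDv] := Df v.
have D w z : U z -> differentiable f z /\ 'D_w f z = 'D_w f z.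
  by move=> Uz; split=> //; exact: df.
apply: (mixed_derivatives_eq oU Ux (D u) (D v) _ _ (cDu x Ux) (cDv x Ux)).
- by move=> z Uz; split=> //; exact: dDu.
- by move=> z Uz; split=> //; exact: dDv.
Qed.

End Schwarz.

(** * Euclidean spaces *)

Section Sums.
Context {R : realType}.
Implicit Types V W : normedModType R.

Lemma differentiable_bigsum V W n (F : 'I_n -> V -> W) x :
  (forall i, differentiable (F i) x) ->
  differentiable (fun z => \sum_i F i z) x.
Proof.
move=> dF; rewrite (_ : (fun z => _) = \sum_i F i); first exact: differentiable_sum.
by apply/funext => z; rewrite fct_sumE.
Qed.

Lemma derive_bigsum V W n (F : 'I_n -> V -> W) x v :
  (forall i, differentiable (F i) x) ->
  'D_v (fun z => \sum_i F i z) x = \sum_i 'D_v (F i) x.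
Proof.
move=> dF; rewrite (_ : (fun z => _) = \sum_i F i).
  by rewrite derive_sum // => i; exact: diff_derivable.
by apply/funext => z; rewrite fct_sumE.
Qed.

Lemma has_coordinates_rV d : @has_coordinates R 'rV[R]_d.
Proof.
have lin (i : 'I_d) : linear (fun u : 'rV[R]_d => u 0 i : R).
  by move=> a u v; rewrite !mxE.
pose c (i : 'I_d) : {linear 'rV[R]_d -> R} :=
  HB.pack (fun u : 'rV[R]_d => u 0 i : R) (GRing.isLinear.Build _ _ _ _ _ (lin i)).
exists d, (fun i => delta_mx 0 i), c.
split=> [i|v]; last by rewrite {1}[v]row_sum_delta.
exact: coord_continuous.
Qed.

End Sums.

(** * Inner products, dual families and operator-valued functions *)

Section Euclidean.
Context {R : realType} {E : normedVectType R} (ip : {dot E for idfun}).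
Implicit Types V W : normedModType R.

Lemma ipC x y : ip x y = ip y x.
Proof. by rewrite hermC expr0 mul1r. Qed.
Lemma ipDl x y z : ip (x + y) z = ip x z + ip y z.
Proof. exact: linearDl. Qed.
Lemma ipZl a x z : ip (a *: x) z = a * ip x z.
Proof. exact: linearZl_LR. Qed.
Lemma ipNl x z : ip (- x) z = - ip x z.
Proof. exact: linearNl. Qed.
Lemma ip0l z : ip 0 z = 0.
Proof. exact: linear0l. Qed.
Lemma ipBl x y z : ip (x - y) z = ip x z - ip y z.
Proof. exact: linearBl. Qed.
Lemma ipDr x y z : ip z (x + y) = ip z x + ip z y.
Proof. by rewrite !(ipC z) ipDl. Qed.
Lemma ipZr a x z : ip z (a *: x) = a * ip z x.
Proof. by rewrite !(ipC z) ipZl. Qed.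
Lemma ipNr x z : ip z (- x) = - ip z x.
Proof. by rewrite !(ipC z) ipNl. Qed.
Lemma ip0r z : ip z 0 = 0.
Proof. by rewrite (ipC z) ip0l. Qed.
Lemma ipBr x y z : ip z (x - y) = ip z x - ip z y.
Proof. by rewrite !(ipC z) ipBl. Qed.

Lemma ip_linear w : linear (fun x => ip x w : R).
Proof. by move=> a x y; rewrite ipDl ipZl. Qed.

Definition ipl w : {linear E -> R} :=
  HB.pack (fun x => ip x w : R) (GRing.isLinear.Build _ _ _ _ _ (ip_linear w)).

Lemma ip_suml n (F : 'I_n -> E) w : ip (\sum_i F i) w = \sum_i ip (F i) w.
Proof. exact: (linear_sum (ipl w)). Qed.

Lemma ip_eq0 x : ip x x = 0 -> x = 0.
Proof.
move=> xx; apply/eqP/negPn/negP => /(neq0_dnorm_gt0 (s := ip)).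
by rewrite xx ltxx.
Qed.

Lemma ip_ge0 x : 0 <= ip x x.
Proof.
by have [->|/(neq0_dnorm_gt0 (s := ip))/ltW //] := eqVneq x 0; rewrite ip0l.
Qed.

Lemma ip_inj x y : (forall w, ip x w = ip y w) -> x = y.
Proof.
by move=> xy; apply/eqP; rewrite -subr_eq0; apply/eqP/ip_eq0; rewrite ipBl xy subrr.
Qed.

(** A reproducing family, built by adding one vector at a time: modulo the expansion [P] for [s],
    the enlarged span is the line through the residual [e'] of the new vector. *)
Lemma dual_family_seq (s : seq E) : exists n (b w : 'I_n -> E),
  forall x, x \in << s >>%VS -> x = \sum_i ip x (w i) *: b i.
Proof.
elim: s => [|e s [n [b [w bw]]]].
  by exists 0%N, (fun=> 0), (fun=> 0) => x; rewrite span_nil memv0 => /eqP->; rewrite big_ord0.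
pose P x := \sum_i ip x (w i) *: b i.
have PD a x y : P (a *: x + y) = a *: P x + P y.
  rewrite /P scaler_sumr -big_split /=; apply: eq_bigr => i _.
  by rewrite ipDl ipZl scalerDl scalerA.
pose e' := e - P e.
have xE x : x \in <<e :: s>>%VS -> exists a, x - P x = a *: e'.
  rewrite span_cons => /memv_addP[_ /vlineP[a ->] [y ys ->]]; exists a.
  by rewrite PD {1}(bw y ys) -/(P y) opprD addrACA subrr addr0 scalerBr.
(* If the residual vanishes, the family for [s] already reproduces the larger span. *)
have [e0|e0] := eqVneq e' 0.
  exists n, b, w => x /xE[a]; rewrite e0 scaler0 => /eqP.
  by rewrite subr_eq0 => /eqP.
have ee0 : ip e' e' != 0 by apply: contra_neq e0; exact: ip_eq0.
(* Chosen so that [ip x w' = ip (x - P x) e' / ip e' e'], the coefficient of [x - P x] along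
   [e']. *)
pose w' := (ip e' e')^-1 *: (e' - \sum_i ip (b i) e' *: w i).
exists n.+1, (fun i => oapp b e' (unlift ord0 i)), (fun i => oapp w w' (unlift ord0 i)).
move=> x /xE[a xa]; rewrite big_ord_recl unlift_none /=.
rewrite (eq_bigr (fun i => ip x (w i) *: b i)) => [|i _]; last by rewrite liftK.
rewrite -/(P x) -[LHS](subrK (P x)) xa; congr (_ *: _ + _).
apply: (mulfI ee0); rewrite ipZr mulrA mulfV // mul1r mulrC.
rewrite -ipZl -xa [LHS]ipBl [RHS]ipBr; congr (_ - _).
rewrite ip_suml [RHS]ipC ip_suml; apply: eq_bigr => i _.
by rewrite !ipZl mulrC [ip (w i) x]ipC mulrC.
Qed.

Lemma dual_family : exists n (b w : 'I_n -> E),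
  forall x, x = \sum_i ip x (w i) *: b i.
Proof.
have [n [b [w bw]]] := dual_family_seq (vbasis (fullv : {vspace E})).
by exists n, b, w => x; apply: bw; rewrite (span_basis (vbasisP _)) memvf.
Qed.

Hypothesis norm_ip : forall x : E, `|x| ^+ 2 = ip x x.

(** Nonnegativity of the squared norms of [x + w] and [x - w] gives [2 |ip x w| <= |x|^2 + |w|^2], a
    bound on the unit ball. *)
Lemma ipl_continuous w : continuous (ipl w).
Proof.
apply: bounded_linear_continuous; exists (1 + `|w| ^+ 2); split=> [|M ltM].
  exact: num_real.
apply/nbhs_ballP; exists 1 => //= x; rewrite -ball_normE /= sub0r normrN => x1.
apply: le_trans (ltW ltM).
have {}x1 : `|x| ^+ 2 <= 1 by rewrite expr_le1 // ltW.
have P1 := ip_ge0 (x + w); have P2 := ip_ge0 (x - w).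
have x0 : 0 <= `|x| ^+ 2 by rewrite exprn_ge0.
have w0 : 0 <= `|w| ^+ 2 by rewrite exprn_ge0.
move: P1 P2; rewrite !ipDl !ipDr !ipNl !ipNr !(ipC w x) -!norm_ip => P1 P2.
rewrite ler_norml; apply/andP; split; lra.
Qed.

Lemma has_coordinates_fd : @has_coordinates R E.
Proof.
have [n [b [w bw]]] := dual_family.
by exists n, b, (fun i => ipl (w i)); split=> // i; exact: ipl_continuous.
Qed.

Lemma Ck_ip V k (U : set V) (F G : V -> E) : open U ->
  Ck k U F -> Ck k U G -> Ck k U (fun x => ip (F x) (G x) : R).
Proof.
move=> oU CF CG; have [n [b [w bw]]] := dual_family.
have C i : Ck k U (fun x => ipl (w i) (F x) *: ipl (b i) (G x)).
  by apply: CkZ => //; apply: Ck_linear => //; exact: ipl_continuous.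
apply: Ck_eq oU _ (Ck_sum oU C) => x _ /=.
rewrite {2}(bw (F x)) ip_suml; apply: eq_bigr => i _.
by rewrite ipZl (ipC (G x)).
Qed.

Lemma app_differentiable V W (T : V -> {linear E -> W}) (F : V -> E) x :
  (forall u, differentiable (fun z => T z u) x) -> differentiable F x ->
  differentiable (fun z => T z (F z)) x.
Proof.
move=> dT dF; have [n [b [w bw]]] := dual_family.
rewrite (_ : (fun z => _) = (fun z => \sum_i ipl (w i) (F z) *: T z (b i))).
  apply: differentiable_bigsum => i; apply: differentiable_scale => //.
  apply: (@differentiable_comp _ _ _ _ F (ipl (w i))) => //.
  by apply: linear_differentiable; exact: ipl_continuous.
apply/funext => z; rewrite {1}(bw (F z)) linear_sum.
by apply: eq_bigr => i _; rewrite linearZ.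
Qed.

(** [T] is differentiable only at each fixed argument, in accordance with [Dop]. Expanding [F] in a
    dual family turns [T z (F z)] into a finite sum of scalar functions times such maps. *)
Lemma derive_app V W (T : V -> {linear E -> W}) (F : V -> E) x v :
  (forall u, differentiable (fun z => T z u) x) -> differentiable F x ->
  'D_v (fun z => T z (F z)) x = 'D_v (fun z => T z (F x)) x + T x ('D_v F x).
Proof.
move=> dT dF; have [n [b [w bw]]] := dual_family.
have appE (G : V -> E) :
    (fun z => T z (G z)) = (fun z => \sum_i ipl (w i) (G z) *: T z (b i)).
  apply/funext => z; rewrite {1}(bw (G z)) linear_sum.
  by apply: eq_bigr => i _; rewrite linearZ.
have dc (G : V -> E) i : differentiable G x ->
    differentiable (fun z => ipl (w i) (G z)) x.
  move=> dG; apply: (@differentiable_comp _ _ _ _ G (ipl (w i))) => //.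
  by apply: linear_differentiable; exact: ipl_continuous.
have D (G : V -> E) : differentiable G x -> 'D_v (fun z => T z (G z)) x =
    \sum_i (ip ('D_v G x) (w i) *: T x (b i) + ip (G x) (w i) *: 'D_v (fun z => T z (b i)) x).
  move=> dG; rewrite appE derive_bigsum => [|i]; last first.
    by apply: differentiable_scale => //; exact: dc.
  apply: eq_bigr => i _; rewrite derive_scale //; last exact: dc.
  by rewrite derive_linear_comp //; exact: ipl_continuous.
rewrite D // (D (fun=> F x)) // addrC [X in T x X](bw ('D_v F x)) linear_sum.
rewrite -big_split; apply: eq_bigr => i _ /=.
by rewrite derive_cst ip0l scale0r add0r linearZ.
Qed.

Lemma derive_ip V (F G : V -> E) x v :
  differentiable F x -> differentiable G x ->
  'D_v (fun z => ip (F z) (G z) : R) x = ip ('D_v F x) (G x) + ip (F x) ('D_v G x).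
Proof.
move=> dF dG.
have dipl u : differentiable (fun z => ipl (G z) u) x.
  rewrite (_ : (fun z => _) = (fun z => ipl u (G z))).
    apply: (@differentiable_comp _ _ _ _ G (ipl u)) => //.
    by apply: linear_differentiable; exact: ipl_continuous.
  by apply/funext => z /=; rewrite ipC.
rewrite (@derive_app _ _ (fun z => ipl (G z)) F) //= addrC; congr (_ + _).
rewrite (_ : (fun z => ip (F x) (G z) : R) = (fun z => ipl (F x) (G z))).
  by rewrite derive_linear_comp //=; [exact: ipC|exact: ipl_continuous].
by apply/funext => z /=; rewrite ipC.
Qed.

Lemma ip_differentiable V (F G : V -> E) x :
  differentiable F x -> differentiable G x ->
  differentiable (fun z => ip (F z) (G z) : R) x.
Proof.
move=> dF dG.
apply: (@app_differentiable _ _ (fun z => ipl (G z)) F) => // u.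
rewrite (_ : (fun z => _) = (fun z => ipl u (G z))).
  apply: (@differentiable_comp _ _ _ _ G (ipl u)) => //.
  by apply: linear_differentiable; exact: ipl_continuous.
by apply/funext => z /=; rewrite ipC.
Qed.

End Euclidean.

(** * Smooth retractions and tangent spaces *)

Section Germs.
Context {R : realType}.
Implicit Types V W : normedModType R.

Definition Cinf_at V W (x : V) (F : V -> W) :=
  exists U : set V, [/\ open U, U x & Cinf U F].

Lemma Cinf_at_diff V W (x : V) (F : V -> W) : Cinf_at x F -> differentiable F x.
Proof. by move=> [U [oU Ux /(_ 1)/Ck_diff]]; exact. Qed.

Lemma Cinf_at_near V W (x : V) (F : V -> W) :
  Cinf_at x F -> \forall z \near x, Cinf_at z F.
Proof. by move=> [U [oU Ux CF]]; apply: (open_near oU Ux) => z Uz; exists U. Qed.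

Lemma near_open V (x : V) (P : V -> Prop) : (\forall z \near x, P z) ->
  exists B : set V, [/\ open B, B x & forall z, B z -> P z].
Proof.
move=> nP; exists [set z | P z]°; split; [exact: open_interior|exact: nP|].
by move=> z /interior_subset.
Qed.

Lemma Cinf_at_eq V W (x : V) (F G : V -> W) :
  (\forall z \near x, F z = G z) -> Cinf_at x F -> Cinf_at x G.
Proof.
move=> /near_open[B [oB Bx BFG]] [U [oU Ux CF]].
exists (U `&` B); split=> //; first exact: openI.
move=> k; apply: (@Ck_eq _ _ _ _ _ F); first exact: openI.
- by move=> y [_ /BFG].
- by apply: Ck_sub (CF k) => y [].
Qed.

Lemma Cinf_at2 V W W' W'' (x : V) (F : V -> W) (G : V -> W') (H : V -> W'') :
  (forall k U, open U -> Ck k U F -> Ck k U G -> Ck k U H) ->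
  Cinf_at x F -> Cinf_at x G -> Cinf_at x H.
Proof.
move=> CH [U [oU Ux CF]] [U' [oU' Ux' CG]]; exists (U `&` U').
have oI := openI oU oU'.
split=> // k; apply: CH => //.
- by apply: Ck_sub (CF k) => y [].
- by apply: Ck_sub (CG k) => y [].
Qed.

Lemma Cinf_at_cst V W (x : V) (w : W) : Cinf_at x (fun=> w).
Proof. by exists setT; split=> //; [exact: openT|move=> k; exact: Ck_cst]. Qed.

Lemma Cinf_atD V W (x : V) (F G : V -> W) :
  Cinf_at x F -> Cinf_at x G -> Cinf_at x (fun z => F z + G z).
Proof. by apply: Cinf_at2 => k U; exact: CkD. Qed.

Lemma Cinf_atZ V W (x : V) (a : V -> R) (G : V -> W) :
  Cinf_at x a -> Cinf_at x G -> Cinf_at x (fun z => a z *: G z).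
Proof. by apply: Cinf_at2 => k U; exact: CkZ. Qed.

Lemma Cinf_atN V W (x : V) (F : V -> W) :
  Cinf_at x F -> Cinf_at x (fun z => - F z).
Proof.
move=> CF; apply: Cinf_at_eq (Cinf_atZ (Cinf_at_cst x (- 1 : R)) CF).
by near=> z; rewrite scaleN1r.
Unshelve. all: by end_near. Qed.

Lemma Cinf_atB V W (x : V) (F G : V -> W) :
  Cinf_at x F -> Cinf_at x G -> Cinf_at x (fun z => F z - G z).
Proof. by move=> CF CG; apply: Cinf_atD => //; exact: Cinf_atN. Qed.

Lemma Cinf_at_sum V W (x : V) n (F : 'I_n -> V -> W) :
  (forall i, Cinf_at x (F i)) -> Cinf_at x (fun z => \sum_i F i z).
Proof.
elim: n F => [F CF|n IH F CF].
  apply: Cinf_at_eq (Cinf_at_cst x 0); near=> z; by rewrite big_ord0.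
apply: Cinf_at_eq (Cinf_atD (CF ord0) (IH (fun i => F (lift ord0 i)) _)) => //.
by near=> z; rewrite big_ord_recl.
Unshelve. all: by end_near. Qed.

Lemma Cinf_at_linear V V' W (x : V) (L : {linear V' -> W}) (F : V -> V') :
  continuous L -> Cinf_at x F -> Cinf_at x (fun z => L (F z)).
Proof.
by move=> cL [U [oU Ux CF]]; exists U; split=> // k; exact: Ck_linear (CF k).
Qed.

Lemma Cinf_atV V (x : V) (a : V -> R) :
  a x != 0 -> Cinf_at x a -> Cinf_at x (fun z => (a z)^-1).
Proof.
move=> a0 Ca.
have : \forall z \near x, a z != 0.
  have ca : {for x, continuous a}.
    exact/differentiable_continuous/Cinf_at_diff.
  exact: cvgr_neq0 _ ca a0.
move=> /near_open[B [oB Bx B0]]; have [U [oU Ux CU]] := Ca.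
exists (U `&` B); split=> //; first exact: openI.
move=> k; apply: CkV; first exact: openI.
- by move=> y [_ /B0].
- by apply: Ck_sub (CU k) => y [].
Qed.

Lemma Cinf_at_comp V V' W (x : V) (F : V' -> W) (G : V -> V') :
  has_coordinates V' -> Cinf_at x G -> Cinf_at (G x) F ->
  Cinf_at x (fun z => F (G z)).
Proof.
move=> cV' CG [U' [oU' U'x CF]].
have cG : {for x, continuous G} by exact/differentiable_continuous/Cinf_at_diff.
have : \forall z \near x, U' (G z) by apply: cG; exact: open_nbhs_nbhs.
move=> /near_open[B [oB Bx BU]]; have [U [oU Ux CU]] := CG.
have oI := openI oU oB.
exists (U `&` B); split=> // k; apply: Ck_comp cV' oI _ _ (CF k).
- by move=> y [_ /BU].
- by apply: Ck_sub (CU k) => y [].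
Qed.

Lemma Cinf_at_derive V W (x : V) (F : V -> W) v :
  Cinf_at x F -> Cinf_at x (fun z => 'D_v F z).
Proof.
by move=> [U [oU Ux CF]]; exists U; split=> // k; have [_ /(_ v)] := CF k.+1.
Qed.

Lemma Cinf_at_Derive V W (x : V) (F : V -> W) (T : V -> V) :
  has_coordinates V -> Cinf_at x F -> Cinf_at x T ->
  Cinf_at x (fun z => 'D_(T z) F z).
Proof.
move=> [n [b [c [cc bc]]]] CF CT.
have CS : Cinf_at x (fun z => \sum_i c i (T z) *: 'D_(b i) F z).
  apply: Cinf_at_sum => i; apply: Cinf_atZ; first exact: Cinf_at_linear.
  exact: Cinf_at_derive.
apply: Cinf_at_eq CS; have := Cinf_at_near CF; apply: filterS => z /Cinf_at_diff dF.
rewrite [RHS]deriveE // [in RHS](bc (T z)) linear_sum.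
by apply: eq_bigr => i _; rewrite linearZ (@deriveE _ _ _ F _ (b i) dF).
Qed.

End Germs.

(** * Calculus on M through local retractions *)

Section Retraction.
Context {R : realType} {E : normedVectType R} (ip : {dot E for idfun}).
Hypothesis norm_ip : forall x : E, `|x| ^+ 2 = ip x x.
Implicit Types (W : normedModType R) (M : set E) (Y : E).

Let hE : has_coordinates E := has_coordinates_fd norm_ip.

Lemma Cinf_at_ip (V : normedModType R) (x : V) (F G : V -> E) :
  Cinf_at x F -> Cinf_at x G -> Cinf_at x (fun z => ip (F z) (G z) : R).
Proof. by apply: Cinf_at2 => k U; exact: Ck_ip. Qed.

Lemma Cinf_at_app (V W : normedModType R) (x : V) (T : V -> {linear E -> W})
    (F : V -> E) :
  (forall u, Cinf_at x (fun z => T z u)) -> Cinf_at x F ->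
  Cinf_at x (fun z => T z (F z)).
Proof.
move=> CT CF; have [n [b [w bw]]] := dual_family ip.
have C : Cinf_at x (fun z => \sum_i ipl ip (w i) (F z) *: T z (b i)).
  apply: Cinf_at_sum => i; apply: Cinf_atZ => //; apply: Cinf_at_linear => //.
  exact: ipl_continuous.
apply: Cinf_at_eq C; near=> z.
by rewrite [in RHS](bw (F z)) linear_sum; apply: eq_bigr => i _; rewrite linearZ.
Unshelve. all: by end_near. Qed.

Definition retraction M (U : set E) (r : E -> E) :=
  [/\ open U, Cinf U r, (forall Z, U Z -> M (r Z)) &
      (forall Z, U Z -> M Z -> r Z = Z)].

Lemma retraction_Cinf_at M U r Y : retraction M U r -> U Y -> Cinf_at Y r.
Proof. by move=> [oU Cr _ _] UY; exists U. Qed.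

(** A curve in [M] satisfies [r o c = c] near 0, and the chain rule gives [dr v = v]. Conversely the
    curve [t -> r (Y + t v)] has velocity [dr v = v]. *)
Lemma tangentP M U r Y v : retraction M U r -> U Y -> M Y ->
  tangent M Y v <-> 'D_v r Y = v.
Proof.
move=> rU UY MY; have [oU Cr rM rK] := rU.
have dr := Cinf_at_diff (retraction_Cinf_at rU UY); split.
  move=> [c [c0 dc [e e0 [Cc cM]]]].
  have bc : ball (0 : R) e 0 by exact: ballxx.
  have dcc : differentiable c 0 by exact: Ck_diff (Cc 1%N) bc.
  have cc : {for 0, continuous c} by exact: differentiable_continuous.
  have vE : v = 'D_1 c 0 by rewrite derive_val.
  rewrite {2}vE; rewrite {1}vE -c0 -derive_comp //; last by rewrite c0.
  apply: near_eq_derive.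
  have nU : \forall t \near 0, U (c t).
    by apply: cc; rewrite c0; exact: open_nbhs_nbhs.
  have nb : \forall t \near 0, ball (0 : R) e t by exact: nbhsx_ballx.
  by near=> t; apply: rK; [near: t|apply: cM; near: t].
move=> rv.
have dl s := line_differentiable Y v s.
have : \forall t \near 0, U (Y + t *: v).
  have cl : {for 0, continuous (fun t : R => Y + t *: v)}.
    exact: differentiable_continuous.
  by apply: cl; rewrite scale0r addr0; exact: open_nbhs_nbhs.
move=> /nbhs_ballP[e e0 eU].
exists (fun t => r (Y + t *: v)); split.
- by rewrite scale0r addr0 rK.
- rewrite -[X in is_derive _ _ _ X]rv -[in 'D_v r Y](addr0 Y) -(scale0r v).
  by apply: is_derive_line; rewrite scale0r addr0.
- exists e => //; split=> [k|t /eU]; last exact: rM.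
  have oB : open (ball (0 : R) e) by exact: ball_open.
  apply: (@Ck_comp _ R E E k (ball (0 : R) e) U r (fun t => Y + t *: v)) => //.
  apply: CkD => //; first exact: Ck_cst.
  apply: CkZ => //; last exact: Ck_cst.
  by apply: (@Ck_lin _ _ _ k _ idfun) => y; exact: cvg_id.
Unshelve. all: by end_near. Qed.

Definition smooth_at M Y W (F : E -> W) := exists (U : set E) (G : E -> W),
    [/\ open U, U Y, Cinf U G & forall Z, U Z -> M Z -> G Z = F Z].

(** If [G] extends [F], then [G o r = F o r] near [Y], as [r] lands in [M]; conversely [F o r] is
    itself an extension. *)
Lemma smooth_atP M U r Y W (F : E -> W) : retraction M U r -> U Y -> M Y ->
  smooth_at M Y F <-> Cinf_at Y (F \o r).
Proof.
move=> rU UY MY; have [oU Cr rM rK] := rU; split.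
  move=> [U' [G [oU' U'Y CG GF]]].
  have CGr : Cinf_at Y (fun z => G (r z)).
    apply: Cinf_at_comp => //; first exact: retraction_Cinf_at rU UY.
    by exists U'; rewrite rK.
  apply: Cinf_at_eq CGr.
  have cr : {for Y, continuous r}.
    exact/differentiable_continuous/Cinf_at_diff/(retraction_Cinf_at rU UY).
  have nU : \forall z \near Y, U' (r z).
    by apply: cr; rewrite rK //; exact: open_nbhs_nbhs.
  apply: filterS2 nU (open_near oU UY (fun z Uz => Uz)) => z U'z Uz.
  by apply: GF => //; exact: rM.
move=> [U' [oU' U'Y CF]]; exists (U `&` U'), (F \o r); split=> //.
- exact: openI.
- by move=> k; apply: Ck_sub (CF k) => z [].
- by move=> z [Uz _] Mz /=; rewrite rK.
Qed.

Lemma differentiable_extension M U r Y W (F G : E -> W) (U' : set E) :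
  retraction M U r -> U Y -> M Y -> open U' -> U' Y -> differentiable G Y ->
  (forall Z, U' Z -> M Z -> G Z = F Z) -> differentiable (F \o r) Y.
Proof.
move=> rU UY MY oU' U'Y dG GF; have [oU Cr rM rK] := rU.
have dr := Cinf_at_diff (retraction_Cinf_at rU UY).
have cr : {for Y, continuous r} by exact: differentiable_continuous.
have nU : \forall z \near Y, U' (r z).
  by apply: cr; rewrite rK //; exact: open_nbhs_nbhs.
have : \forall z \near Y, G (r z) = F (r z).
  apply: filterS2 nU (open_near oU UY (fun z Uz => Uz)) => z U'z Uz.
  by apply: GF => //; exact: rM.
move=> /near_open[B [oB BY BGF]].
apply: (diff_eq_open oB BY (F := G \o r)) => //.
by apply: differentiable_comp => //; rewrite rK.
Qed.

(** For each admissible curve [F o c = (F o r) o c] near 0, so all curves give the same derivative;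
    tangency of [v] supplies a curve, and the default of [Dalong] is not reached. *)
Lemma DalongE M U r Y W (F : E -> W) v : retraction M U r -> U Y -> M Y ->
  tangent M Y v -> differentiable (F \o r) Y ->
  Dalong M F Y v = 'D_v (F \o r) Y.
Proof.
move=> rU UY MY [c0 cv0] dF; have [oU Cr rM rK] := rU.
have D c : curve_through M Y v c -> is_derive (0 : R) 1 (F \o c) ('D_v (F \o r) Y).
  move=> [cY dc [e e0 [Cc cM]]].
  have bc : ball (0 : R) e 0 by exact: ballxx.
  have dcc : differentiable c 0 by exact: Ck_diff (Cc 1%N) bc.
  have cc : {for 0, continuous c} by exact: differentiable_continuous.
  have nU : \forall t \near 0, U (c t).
    by apply: cc; rewrite cY; exact: open_nbhs_nbhs.
  have nb : \forall t \near 0, ball (0 : R) e t by exact: nbhsx_ballx.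
  have nE : \forall t \near 0, ((F \o r) \o c) t = (F \o c) t.
    by near=> t; rewrite /= rK //; [near: t|apply: cM; near: t].
  apply: (near_eq_is_derive nE).
  have vE : v = 'D_1 c 0 by rewrite derive_val.
  rewrite [in X in is_derive _ _ _ X]vE -cY -derive_comp //; last by rewrite cY.
  apply: derivableP; apply: diff_derivable; apply: differentiable_comp => //.
  by rewrite cY.
apply: xget_unique; first by exists c0 => //; exact: D.
move=> w [c cv dw].
by rewrite -(@derive_val _ _ _ _ _ _ _ dw) (@derive_val _ _ _ _ _ _ _ (D c cv)).
Unshelve. all: by end_near. Qed.

End Retraction.

(** * Coordinate frames and differentiation rules on M *)

Section Manifold.
Context {R : realType} {E : normedVectType R} (ip : {dot E for idfun}).
Hypothesis norm_ip : forall x : E, `|x| ^+ 2 = ip x x.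
Implicit Types (W : normedModType R) (M : set E) (Y : E).

Lemma derive_linear_sum (V W : normedModType R) (F : V -> W) x n (a : 'I_n -> R)
    (b : 'I_n -> V) : differentiable F x ->
  'D_(\sum_i a i *: b i) F x = \sum_i a i *: 'D_(b i) F x.
Proof.
move=> dF; rewrite deriveE // linear_sum; apply: eq_bigr => i _.
by rewrite linearZ deriveE.
Qed.

(** The frame consists of the coordinate fields of the parametrization: the partial derivatives of
    [psi], evaluated at [phi Z]. *)
Lemma submanifold_frame d M Y : submanifold d M -> M Y ->
  exists U r (e : 'I_d -> E -> E), [/\ retraction M U r, U Y,
    (forall i Z, U Z -> Cinf_at Z (e i)) &
    forall Z, U Z -> M Z -> free [tuple e i Z | i < d] /\
      forall v, tangent M Z v <-> exists a : 'I_d -> R, v = \sum_i a i *: e i Z].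
Proof.
move=> sM MY; have [U [V [phi [psi [[oU UY oV] [Cphi Cpsi MU VM]]]]]] := sM Y MY.
have dphi Z : U Z -> differentiable phi Z by exact: Ck_diff (Cphi 1%N).
have dpsi x : V x -> differentiable psi x by exact: Ck_diff (Cpsi 1%N).
(* The chart is known to land in [V] only on [M], so [U] is shrunk until [psi (phi Z)] makes sense
   off [M] too. *)
pose U' := [set Z | U Z /\ V (phi Z)].
have oU' : open U'.
  rewrite openE => Z [UZ VZ]; rewrite /interior.
  have cphi : {for Z, continuous phi} by exact/differentiable_continuous/dphi.
  have nV : \forall z \near Z, V (phi z) by apply: cphi; exact: open_nbhs_nbhs.
  by apply: filterS2 nV (open_near oU UZ (fun z Uz => Uz)) => z Vz Uz; split.
have crV := @has_coordinates_rV R d.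
pose r Z := psi (phi Z).
have rU : retraction M U' r.
  split=> //.
  - move=> k; apply: (Ck_comp crV oU' (U' := V)) (Cpsi k); first by move=> z [].
    by apply: Ck_sub (Cphi k) => z [].
  - by move=> Z [_ /VM[]].
  - by move=> Z [UZ _] MZ; have [] := MU Z MZ UZ.
pose e i Z := 'D_(delta_mx 0 i) psi (phi Z).
have De x v : V x -> 'D_v psi x = \sum_i v 0 i *: 'D_(delta_mx 0 i) psi x.
  move=> Vx; rewrite {1}(row_sum_delta v) derive_linear_sum //; exact: dpsi.
have Dphi x v : V x -> 'D_('D_v psi x) phi (psi x) = v.
  move=> Vx; have [_ Ux pK] := VM x Vx.
  rewrite -derive_comp; [|exact: dpsi|exact: dphi].
  rewrite (derive_eq_open v oV Vx (G := fun y => y)); first exact: derive_id.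
  by move=> y /VM[].
exists U', r, e; split=> //.
- by have [VY _] := MU Y MY UY.
- move=> i Z [UZ VZ]; apply: (Cinf_at_comp crV (F := fun x => 'D_(delta_mx 0 i) psi x)).
    by exists U.
  by apply: Cinf_at_derive; exists V.
move=> Z U'Z MZ; have [UZ VZ] := U'Z; have [_ rZ] := MU Z MZ UZ.
have tan v : tangent M Z v <-> exists a : 'I_d -> R, v = \sum_i a i *: e i Z.
  rewrite (tangentP norm_ip v rU U'Z MZ).
  have -> : 'D_v r Z = 'D_('D_v phi Z) psi (phi Z).
    by rewrite -derive_comp //; [exact: dphi|exact: dpsi].
  split=> [<-|[a ->]]; first by rewrite De //; exists (fun i => 'D_v phi Z 0 i).
  rewrite -derive_linear_sum; last exact: dpsi.
  by rewrite -{2}rZ Dphi.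
(* The differential of [phi] is a left inverse of that of [psi], so it recovers the coefficients of
   a vanishing combination. *)
split=> //; apply/freeP => a.
rewrite (eq_bigr (fun i => a i *: e i Z)) => [|i _]; last first.
  by rewrite (nth_map i) ?size_enum_ord // nth_ord_enum.
rewrite -derive_linear_sum => [a0 i|]; last exact: dpsi.
have := Dphi (phi Z) (\sum_i a i *: delta_mx 0 i) VZ.
rewrite a0 derive0 => /esym/rowP/(_ i); rewrite summxE mxE (bigD1 i) //= big1 => [|j ji].
  by rewrite !mxE !eqxx mulr1 addr0.
by rewrite !mxE eqxx /= eq_sym (negbTE ji) mulr0.
Qed.

Section Along.
Variables (M : set E) (Y : E).
Hypothesis MY : M Y.
Hypothesis retY : exists U r, retraction M U r /\ U Y.

(** Weaker than [smooth_at], because the rules for [Dalong] are also applied to ambient gradients,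
    which are only C^1. *)
Definition dif_at W (F : E -> W) := exists (U : set E) (G : E -> W),
    [/\ open U, U Y, differentiable G Y & forall Z, U Z -> M Z -> G Z = F Z].

Lemma dif_atP U r W (F : E -> W) : retraction M U r -> U Y ->
  dif_at F <-> differentiable (F \o r) Y.
Proof.
move=> rU UY; split=> [[U' [G [oU' UY' dG GF]]]|dF].
  exact: (differentiable_extension rU UY MY oU' UY' dG GF).
have [oU _ _ rK] := rU.
by exists U, (F \o r); split=> // Z UZ MZ /=; rewrite rK.
Qed.

Lemma smooth_dif W (F : E -> W) : smooth_at M Y F -> dif_at F.
Proof.
move=> [U [G [oU UY CG GF]]]; exists U, G; split=> //.
exact: Ck_diff (CG 1%N) UY.
Qed.

Lemma C1_dif W (F : E -> W) : C1_on M F -> dif_at F.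
Proof.
move=> /(_ Y MY) [U [G [oU UY CG GF]]]; exists U, G; split=> //.
exact: Ck_diff CG UY.
Qed.

Variable v : E.
Hypothesis tv : tangent M Y v.

Lemma Dalong_eq W (F F' : E -> W) : dif_at F -> (forall Z, M Z -> F Z = F' Z) ->
  Dalong M F Y v = Dalong M F' Y v.
Proof.
move=> dF FF; have [U [r [rU UY]]] := retY.
have dF' : dif_at F'.
  have [U' [G [oU' U'Y dG GF]]] := dF; exists U', G; split=> // Z UZ MZ.
  by rewrite GF ?FF.
have /(dif_atP _ rU UY) D := dF; have /(dif_atP _ rU UY) D' := dF'.
rewrite !(DalongE rU) //; have [oU _ rM _] := rU.
by apply: derive_eq_open oU UY _ => z Uz /=; exact/FF/rM.
Qed.

Lemma Dalong_dir W (F : E -> W) a u : tangent M Y u -> dif_at F ->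
  Dalong M F Y (a *: v + u) = a *: Dalong M F Y v + Dalong M F Y u.
Proof.
move=> tu dF; have [U [r [rU UY]]] := retY.
have /(dif_atP _ rU UY) D := dF.
have tvu : tangent M Y (a *: v + u).
  apply/(tangentP norm_ip _ rU UY MY).
  move: tv tu => /(tangentP norm_ip _ rU UY MY) tv' /(tangentP norm_ip _ rU UY MY) tu'.
  have dr := Cinf_at_diff (retraction_Cinf_at rU UY).
  by rewrite deriveE // linearP -!deriveE // tv' tu'.
by rewrite !(DalongE rU) // !deriveE // linearP.
Qed.

Lemma DalongD W (F G : E -> W) : dif_at F -> dif_at G ->
  Dalong M (fun Z => F Z + G Z) Y v = Dalong M F Y v + Dalong M G Y v.
Proof.
move=> dF dG; have [U [r [rU UY]]] := retY.
have /(dif_atP _ rU UY) D := dF; have /(dif_atP _ rU UY) D' := dG.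
rewrite (DalongE rU) //; last exact: differentiableD D D'.
rewrite (DalongE rU UY MY tv D) (DalongE rU UY MY tv D').
by rewrite -deriveD //; apply: diff_derivable.
Qed.

Lemma Dalong_scale W (a : E -> R) (F : E -> W) : dif_at a -> dif_at F ->
  Dalong M (fun Z => a Z *: F Z) Y v =
  Dalong M a Y v *: F Y + a Y *: Dalong M F Y v.
Proof.
move=> da dF; have [U [r [rU UY]]] := retY; have [_ _ _ rK] := rU.
have /(dif_atP _ rU UY) D := da; have /(dif_atP _ rU UY) D' := dF.
rewrite (DalongE rU) //; last exact: (differentiable_scale D D').
rewrite (DalongE rU UY MY tv D) (DalongE rU UY MY tv D').
by rewrite -[X in 'D_v X Y]/(fun Z => (a \o r) Z *: (F \o r) Z) derive_scale //= rK.
Qed.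

Lemma Dalong_app W (T : E -> {linear E -> W}) (F : E -> E) :
  (forall u, dif_at (fun Z => T Z u)) -> dif_at F ->
  Dalong M (fun Z => T Z (F Z)) Y v =
  Dalong M (fun Z => T Z (F Y)) Y v + T Y (Dalong M F Y v).
Proof.
move=> dT dF; have [U [r [rU UY]]] := retY; have [_ _ _ rK] := rU.
have D u : differentiable (fun Z => T (r Z) u) Y.
  by have /(dif_atP _ rU UY) := dT u.
have /(dif_atP _ rU UY) D' := dF.
rewrite (DalongE rU) //; last first.
  exact: (app_differentiable norm_ip (T := fun Z => T (r Z)) D D').
rewrite (DalongE rU (F := fun Z => T Z (F Y))) //; last exact: D.
rewrite (DalongE rU (F := F)) //.
rewrite -[X in 'D_v X Y = _]/(fun Z => T (r Z) ((F \o r) Z)).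
by rewrite (derive_app norm_ip _ (T := fun Z => T (r Z)) D D') /= rK.
Qed.

Lemma Dalong_ip (F G : E -> E) : dif_at F -> dif_at G ->
  Dalong M (fun Z => ip (F Z) (G Z) : R) Y v =
  ip (Dalong M F Y v) (G Y) + ip (F Y) (Dalong M G Y v).
Proof.
move=> dF dG; have [U [r [rU UY]]] := retY; have [_ _ _ rK] := rU.
have /(dif_atP _ rU UY) D := dF; have /(dif_atP _ rU UY) D' := dG.
rewrite (DalongE rU) //; last exact: (ip_differentiable norm_ip D D').
rewrite (DalongE rU UY MY tv D) (DalongE rU UY MY tv D').
rewrite -[X in 'D_v X Y = _]/(fun Z => ip ((F \o r) Z) ((G \o r) Z) : R).
by rewrite (derive_ip norm_ip _ D D') /= rK.
Qed.

Lemma Dalong_cst W (w : W) : Dalong M (fun=> w) Y v = 0.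
Proof.
have [U [r [rU UY]]] := retY.
by rewrite (DalongE rU) // ?derive_cst //; exact: differentiable_cst.
Qed.

End Along.

Section Smooth.
Variables (M : set E) (Y : E).
Hypothesis MY : M Y.
Hypothesis retY : exists U r, retraction M U r /\ U Y.

Lemma smooth_at2 W W' W'' (F : E -> W) (G : E -> W') (H : E -> W'') :
  (forall r, Cinf_at Y (F \o r) -> Cinf_at Y (G \o r) -> Cinf_at Y (H \o r)) ->
  smooth_at M Y F -> smooth_at M Y G -> smooth_at M Y H.
Proof.
have [U [r [rU UY]]] := retY.
by move=> C /(smooth_atP norm_ip _ rU UY MY) CF /(smooth_atP norm_ip _ rU UY MY) CG;
  apply/(smooth_atP norm_ip _ rU UY MY)/C.
Qed.

Lemma smooth_atD W (F G : E -> W) : smooth_at M Y F -> smooth_at M Y G ->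
  smooth_at M Y (fun Z => F Z + G Z).
Proof. by apply: smooth_at2 => r; exact: Cinf_atD. Qed.

Lemma smooth_atB W (F G : E -> W) : smooth_at M Y F -> smooth_at M Y G ->
  smooth_at M Y (fun Z => F Z - G Z).
Proof. by apply: smooth_at2 => r; exact: Cinf_atB. Qed.

Lemma smooth_atZ W (a : E -> R) (G : E -> W) : smooth_at M Y a -> smooth_at M Y G ->
  smooth_at M Y (fun Z => a Z *: G Z).
Proof. by apply: smooth_at2 => r; exact: Cinf_atZ. Qed.

Lemma smooth_at_ip (F G : E -> E) : smooth_at M Y F -> smooth_at M Y G ->
  smooth_at M Y (fun Z => ip (F Z) (G Z) : R).
Proof. by apply: smooth_at2 => r; exact: Cinf_at_ip. Qed.

Lemma smooth_at_cst W (w : W) : smooth_at M Y (fun=> w).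
Proof.
have [U [r [rU UY]]] := retY; apply/(smooth_atP norm_ip _ rU UY MY).
exact: Cinf_at_cst.
Qed.

Lemma smooth_at_app W (T : E -> {linear E -> W}) (F : E -> E) :
  (forall u, smooth_at M Y (fun Z => T Z u)) -> smooth_at M Y F ->
  smooth_at M Y (fun Z => T Z (F Z)).
Proof.
move=> CT CF; have [U [r [rU UY]]] := retY; have P := smooth_atP norm_ip _ rU UY MY.
apply/P; apply: (Cinf_at_app norm_ip (T := fun Z => T (r Z)) (F := F \o r)).
  by move=> u; have /P := CT u.
exact/P.
Qed.

Lemma smooth_atV (a : E -> R) : a Y != 0 -> smooth_at M Y a ->
  smooth_at M Y (fun Z => (a Z)^-1).
Proof.
move=> a0; have [U [r [rU UY]]] := retY; have P := smooth_atP norm_ip _ rU UY MY.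
have [_ _ _ rK] := rU.
by move=> /P Ca; apply/P; apply: (Cinf_atV _ Ca); rewrite /= rK.
Qed.

Lemma smooth_at_sum W n (F : 'I_n -> E -> W) : (forall i, smooth_at M Y (F i)) ->
  smooth_at M Y (fun Z => \sum_i F i Z).
Proof.
move=> CF; have [U [r [rU UY]]] := retY; have P := smooth_atP norm_ip _ rU UY MY.
apply/P; apply: (Cinf_at_sum (F := fun i => F i \o r)) => i; exact/P.
Qed.

Lemma smooth_at_eq W (F G : E -> W) (U : set E) : open U -> U Y ->
  (forall Z, U Z -> M Z -> F Z = G Z) -> smooth_at M Y F -> smooth_at M Y G.
Proof.
move=> oU UY FG [U' [F' [oU' UY' CF FF]]]; exists (U `&` U'), F'; split=> //.
- exact: openI.
- by move=> k; apply: Ck_sub (CF k) => z [].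
- by move=> Z [UZ UZ'] MZ; rewrite FF // FG.
Qed.

(** Tangency of [tau] is asked near [Y] only, so that local sections of a bundle are allowed. The
    smooth extension is the derivative of [F o r] along [tau o r]. *)
Lemma smooth_at_Dalong W (F : E -> W) (tau : E -> E) (U' : set E) :
  open U' -> U' Y ->
  (forall Z, U' Z -> M Z -> tangent M Z (tau Z)) ->
  smooth_at M Y F -> smooth_at M Y tau ->
  smooth_at M Y (fun Z => Dalong M F Z (tau Z)).
Proof.
move=> oU' U'Y ttau CF Ct.
have [U [r [rU UY]]] := retY; have P := smooth_atP norm_ip _ rU UY MY.
move: (CF) => /P CFr; move: (Ct) => /P Ctr; have [oU Cr rM rK] := rU.
have [U1 [oU1 U1Y C1]] := CFr.
have [U2 [oU2 U2Y C2]] :=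
  Cinf_at_Derive (has_coordinates_fd norm_ip) CFr Ctr.
exists (U `&` U' `&` (U1 `&` U2)), (fun z => 'D_((tau \o r) z) (F \o r) z); split.
- by do !apply: openI.
- by [].
- by move=> k; apply: Ck_sub (C2 k) => z [_ []].
move=> Z [[UZ U'Z] [U1Z _]] MZ; rewrite (DalongE rU UZ MZ) //= ?rK //.
- exact: ttau.
- exact: Ck_diff (C1 1%N) U1Z.
Qed.

End Smooth.

End Manifold.

(** * Projections onto framed bundles *)

Section Frames.
Context {R : realType} {E : normedVectType R} (ip : {dot E for idfun}).
Variables (d : nat) (M : set E) (g : E -> 'End(E)).
Hypothesis hA : ambient_structure ip d M g.
Implicit Types (W : normedModType R) (Y : E).

Let norm_ip := ambient_norm hA.
Let smooth_g := ambient_smooth hA.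
Let g_sym := ambient_selfadjoint hA.
Let g_pos := ambient_posdef hA.

Lemma ambient_retraction Y : M Y -> exists U r, retraction M U r /\ U Y.
Proof.
move=> MY; have [U [r [e [rU UY _ _]]]] :=
  submanifold_frame norm_ip (ambient_manifold hA) MY.
by exists U, r.
Qed.

Definition fspan n (e : 'I_n -> E) : set E :=
  [set v | exists a : 'I_n -> R, v = \sum_i a i *: e i].

Lemma fspan0 n (e : 'I_n -> E) : fspan e 0.
Proof. by exists (fun=> 0); rewrite big1 // => i _; rewrite scale0r. Qed.

Lemma fspanP n (e : 'I_n -> E) a u v : fspan e u -> fspan e v ->
  fspan e (a *: u + v).
Proof.
move=> [b ->] [c ->]; exists (fun i => a * b i + c i).
rewrite scaler_sumr -big_split; apply: eq_bigr => i _ /=.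
by rewrite scalerDl scalerA.
Qed.

Lemma fspan_recl n (e : 'I_n.+1 -> E) v : fspan e v <->
  exists a w, fspan (fun i => e (lift ord0 i)) w /\ v = a *: e ord0 + w.
Proof.
split=> [[a ->]|[a [_ [[b ->] ->]]]].
  exists (a ord0), (\sum_i a (lift ord0 i) *: e (lift ord0 i)).
  by rewrite big_ord_recl; split=> //; exists (fun i => a (lift ord0 i)).
exists (fun i => oapp b a (unlift ord0 i)); rewrite big_ord_recl unlift_none /=.
by congr (_ + _); apply: eq_bigr => i _; rewrite liftK.
Qed.

Definition free_family n (e : 'I_n -> E) :=
  forall a : 'I_n -> R, \sum_i a i *: e i = 0 -> forall i, a i = 0.

Lemma metric_eq0 Y u : M Y -> ip u (g Y u) = 0 -> u = 0.
Proof.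
by move=> MY u0; apply/eqP/negPn/negP => /(g_pos MY); rewrite u0 ltxx.
Qed.

(* [Q u] is the element of [S] representing [ip u] for the inner product
   defined by [g Y]. *)
Definition represents Y (S : set E) (Q : E -> E) :=
  (forall u, S (Q u)) /\ (forall u w, S w -> ip (Q u) (g Y w) = ip u w).

(** [Q Z] plays the role of [Pi g^-1], but is built without inverting [g]. Its smoothness clause
    concerns the pairings of [F] with the frame and not [F] itself, so that it applies to a C^1
    ambient gradient. *)
Lemma gram_schmidt (U : set E) n (e : 'I_n -> E -> E) : open U ->
  (forall i Z, U Z -> M Z -> smooth_at M Z (e i)) ->
  (forall Z, U Z -> M Z -> free_family (e ^~ Z)) ->
  exists Q : E -> E -> E,
    (forall Z, U Z -> M Z -> represents Z (fspan (e ^~ Z)) (Q Z)) /\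
    (forall F : E -> E,
      (forall i Z, U Z -> M Z -> smooth_at M Z (fun z => ip (F z) (e i z) : R)) ->
      forall Z, U Z -> M Z -> smooth_at M Z (fun z => Q z (F z))).
Proof.
move=> oU; elim: n e => [e _ _|n IH e se fe].
  exists (fun _ _ => 0); split=> [Z UZ MZ|F _ Z UZ MZ].
    split=> [u|u w [a ->]]; first exact: fspan0.
    by rewrite big_ord0 ip0l ip0r.
  by apply: smooth_at_cst => //; exact: ambient_retraction.
pose e' i := e (lift ord0 i); pose e0 := e ord0.
have [|Z UZ MZ a a0 i|Q [QP Qs]] := IH e'.
- by move=> i Z; exact: se.
- have := fe Z UZ MZ (fun i => oapp a 0 (unlift ord0 i)) _ (lift ord0 i).
  rewrite liftK /=; apply; rewrite big_ord_recl unlift_none scale0r add0r.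
  by rewrite -[RHS]a0; apply: eq_bigr => j _; rewrite liftK.
have sg Z F : M Z -> smooth_at M Z F -> smooth_at M Z (fun z => g z (F z)).
  move=> MZ sF; apply: (smooth_at_app norm_ip MZ (ambient_retraction MZ) (T := g)) => // u.
  exact: smooth_g.
(* [f] is the component of [e0] that is [g]-orthogonal to the span of the other vectors. *)
have [f fE] : exists f, f = fun Z => e0 Z - Q Z (g Z (e0 Z)) by eexists.
have fZ Z : f Z = e0 Z - Q Z (g Z (e0 Z)) by rewrite fE.
have sf Z : U Z -> M Z -> smooth_at M Z f.
  move=> UZ MZ; rewrite fE; apply: (smooth_atB norm_ip MZ (ambient_retraction MZ)).
    exact: se.
  apply: (Qs (fun z => g z (e0 z))) => // i Z' UZ' MZ'.
  apply: (smooth_at_ip norm_ip MZ' (ambient_retraction MZ')); last exact: se.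
  by apply: sg => //; exact: se.
have f_perp Z w : U Z -> M Z -> fspan (e' ^~ Z) w -> ip (f Z) (g Z w) = 0.
  move=> UZ MZ Sw; have [_ QE] := QP Z UZ MZ.
  by rewrite fZ ipBl QE // g_sym // subrr.
(* If [f] vanished, [e0] would be a combination of the other vectors: a relation with coefficient 1
   at [ord0]. *)
have f0 Z : U Z -> M Z -> f Z != 0.
  move=> UZ MZ; apply/eqP => fZ0; have [a aE] := (QP Z UZ MZ).1 (g Z (e0 Z)).
  have h := fe Z UZ MZ (fun i => oapp (fun j => - a j) 1 (unlift ord0 i)) _ ord0.
  suff : (1 : R) = 0 by move/eqP; rewrite oner_eq0.
  rewrite unlift_none /= in h; apply: h.
  rewrite big_ord_recl unlift_none /= scale1r -/(e0 Z).
  rewrite -[RHS]fZ0 fZ aE -sumrN; congr (_ + _); apply: eq_bigr => j _.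
  by rewrite liftK /= scaleNr.
have ff0 Z : U Z -> M Z -> ip (f Z) (g Z (f Z)) != 0.
  by move=> UZ MZ; rewrite gt_eqF //; apply: g_pos => //; exact: f0.
(* To the representative for the smaller span is added the one for the line through [f], which is
   [g]-orthogonal to it. *)
exists (fun Z u => ((ip (f Z) (g Z (f Z)))^-1 * ip u (f Z)) *: f Z + Q Z u).
split=> [Z UZ MZ|F sF Z UZ MZ].
  have [Qin QE] := QP Z UZ MZ; split=> [u|u w].
    apply/fspan_recl; set c := _ * _; exists c.
    exists (c *: - Q Z (g Z (e0 Z)) + Q Z u); split.
      apply: fspanP => //; rewrite -[- _]addr0 -scaleN1r.
      by apply: fspanP => //; exact: fspan0.
    by rewrite fZ scalerBr scalerN addrA.
  move=> /fspan_recl[a [w' [Sw' ->]]]; rewrite -/(e0 Z).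
  (* The test vector is split orthogonally in the same way, so that the mixed terms vanish. *)
  have -> : a *: e0 Z + w' = a *: f Z + (a *: Q Z (g Z (e0 Z)) + w').
    by rewrite fZ scalerBr addrA subrK.
  set x := _ + w'; have Sx : fspan (e' ^~ Z) x by exact: fspanP. clearbody x.
  rewrite (linearP (g Z)) [ip (_ + _) _]ipDl !ipDr !ipZl !ipZr (f_perp Z x) // (QE u x) //.
  rewrite -[ip (Q Z u) (g Z (f Z))]g_sym // [ip (g Z _) _]ipC (f_perp Z (Q Z u)) //.
  by rewrite !mulr0 addr0 add0r mulrCA (mulrC _^-1) mulrVK ?unitfE ?ff0.
have sQF : smooth_at M Z (fun z => Q z (F z)).
  by apply: Qs => // i Z' UZ' MZ'; exact: sF.
(* [F] need not be smooth. Symmetry of [Q] moves it from [g e0] onto [F], which leaves the pairing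
   of [F] with [e0] and the smooth [Q F]. *)
have sFf : smooth_at M Z (fun z => ip (F z) (f z) : R).
  apply: (smooth_at_eq oU UZ (F := fun z => ip (F z) (e0 z) - ip (Q z (F z)) (g z (e0 z)))).
    move=> z Uz Mz; rewrite fZ ipBr; congr (_ - _); have [Qin QE] := QP z Uz Mz.
    rewrite -[RHS](QE (F z)) // -[RHS]g_sym // [RHS]ipC.
    by rewrite (QE (g z (e0 z)) (Q z (F z))) // ipC.
  apply: (smooth_atB norm_ip MZ (ambient_retraction MZ)); first exact: sF.
  by apply: (smooth_at_ip norm_ip MZ (ambient_retraction MZ)) => //; apply: sg => //; exact: se.
have rZ := ambient_retraction MZ.
apply: (smooth_atD norm_ip MZ rZ) => //; apply: (smooth_atZ norm_ip MZ rZ).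
  apply: (smooth_atZ norm_ip MZ rZ) => //.
  apply: (smooth_atV norm_ip MZ rZ); first exact: ff0.
  by apply: (smooth_at_ip norm_ip MZ rZ); [exact: sf|apply: sg => //; exact: sf].
exact: sf.
Qed.

(** A common form for the tangent bundle, its subbundles and the trivial bundle with fiber [E]. *)
Definition framed_at (H : E -> set E) Y := exists (U : set E) n (e : 'I_n -> E -> E),
  [/\ open U, U Y, forall i Z, U Z -> M Z -> smooth_at M Z (e i),
      forall Z, U Z -> M Z -> free_family (e ^~ Z) &
      forall Z, U Z -> M Z -> H Z = fspan (e ^~ Z)].

(** Forgets the frame: smoothness is now tested on the pairings of [F] with arbitrary local sections
    of [H]. *)
Lemma framed_representative (H : E -> set E) Y : framed_at H Y ->
  exists (U : set E) (Q : E -> E -> E), [/\ open U, U Y,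
    forall Z, U Z -> M Z -> represents Z (H Z) (Q Z) &
    forall F : E -> E,
      (forall xi Z, smooth_at M Z xi -> (forall Z', U Z' -> M Z' -> H Z' (xi Z')) ->
         U Z -> M Z -> smooth_at M Z (fun z => ip (F z) (xi z) : R)) ->
      forall Z, U Z -> M Z -> smooth_at M Z (fun z => Q z (F z))].
Proof.
move=> [U [n [e [oU UY se fe He]]]]; have [Q [QP Qs]] := gram_schmidt oU se fe.
exists U, Q; split=> // [Z UZ MZ|F sF Z UZ MZ]; first by rewrite He //; exact: QP.
apply: Qs => // i Z' UZ' MZ'; apply: sF => //; first exact: se.
move=> Z1 UZ1 MZ1; rewrite He //; exists (fun j => (j == i)%:R).
by rewrite (bigD1 i) //= eqxx scale1r big1 ?addr0 // => j /negbTE->; rewrite scale0r.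
Qed.

Lemma framed_subspace H Y a u v : M Y -> framed_at H Y ->
  H Y u -> H Y v -> H Y (a *: u + v).
Proof. by move=> MY [U [n [e [oU UY _ _ He]]]]; rewrite He //; exact: fspanP. Qed.

Lemma framed0 H Y : M Y -> framed_at H Y -> H Y 0.
Proof. by move=> MY [U [n [e [oU UY _ _ He]]]]; rewrite He //; exact: fspan0. Qed.

Lemma framedB H Y u v : M Y -> framed_at H Y -> H Y u -> H Y v -> H Y (u - v).
Proof.
move=> MY fH Hu Hv; rewrite addrC -scaleN1r; exact: (framed_subspace _ MY fH).
Qed.

Lemma represents_eq H Y Q u v : M Y -> framed_at H Y -> represents Y (H Y) Q ->
  H Y v -> (forall w, H Y w -> ip v (g Y w) = ip u w) -> Q u = v.
Proof.
move=> MY fH [Qin QE] Hv vE; apply/eqP; rewrite -subr_eq0; apply/eqP/(metric_eq0 MY).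
have Hd : H Y (Q u - v) by exact: (framedB MY fH).
by rewrite {1}ipBl QE // vE // subrr.
Qed.

Lemma represents_linear H Y Q : M Y -> framed_at H Y -> represents Y (H Y) Q ->
  linear Q.
Proof.
move=> MY fH QP a u v; have [Qin QE] := QP.
apply: (represents_eq MY fH QP); first exact: (framed_subspace _ MY fH).
by move=> w Hw; rewrite !ipDl !ipZl !QE.
Qed.

Lemma ginvK Y u : M Y -> ginv g Y (g Y u) = u.
Proof.
move=> MY; apply: lker0_lfunK; rewrite -subv0; apply/subvP => x.
rewrite memv_ker memv0 => /eqP gx0; apply/eqP/(metric_eq0 MY).
by rewrite gx0 ip0r.
Qed.

Lemma gK Y u : M Y -> g Y (ginv g Y u) = u.
Proof.
move=> MY; apply: lker0_lfunVK; rewrite -subv0; apply/subvP => x.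
rewrite memv_ker memv0 => /eqP gx0; apply/eqP/(metric_eq0 MY).
by rewrite gx0 ip0r.
Qed.

(** [Q o g] has the defining property of the projection and is the only operator that has it, so the
    choice in [gproj] returns it and not its default. *)
Lemma gprojE H Y Q u : M Y -> framed_at H Y -> represents Y (H Y) Q ->
  gproj ip g H Y u = Q (g Y u).
Proof.
move=> MY fH QP; have [Qin QE] := QP.
have lQ : linear (fun u => Q (g Y u)).
  by move=> a x y; rewrite linearP (represents_linear MY fH QP).
pose L : {linear E -> E} :=
  HB.pack (fun u => Q (g Y u)) (GRing.isLinear.Build _ _ _ _ _ lQ).
have LE x : linfun L x = Q (g Y x) by rewrite lfunE.
rewrite -LE; congr (fun_of_lfun _ u); apply: xget_unique.
  split=> [v|v w Hw]; rewrite LE //.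
  by rewrite QE // g_sym.
move=> P [Pin PE]; apply/lfunP => x; rewrite LE; apply/esym.
apply: (represents_eq MY fH QP) => // w Hw.
by rewrite PE // g_sym.
Qed.

Lemma represents_ginv H Y Q u : M Y -> framed_at H Y -> represents Y (H Y) Q ->
  gproj ip g H Y (ginv g Y u) = Q u.
Proof. by move=> MY fH QP; rewrite (gprojE _ MY fH QP) gK. Qed.

Section Projection.
Variables (H : E -> set E) (Y : E).
Hypotheses (MY : M Y) (fH : framed_at H Y).

Lemma framed_represents : exists Q, represents Y (H Y) Q.
Proof.
by have [U [Q [oU UY QP _]]] := framed_representative fH; exists (Q Y); exact: QP.
Qed.

Lemma gproj_in u : H Y (gproj ip g H Y u).
Proof.
have [Q QP] := framed_represents; rewrite (gprojE _ MY fH QP); exact: QP.1.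
Qed.

Lemma gproj_ip u w : H Y w -> ip (gproj ip g H Y u) (g Y w) = ip u (g Y w).
Proof.
have [Q QP] := framed_represents; rewrite (gprojE _ MY fH QP) => Hw.
by rewrite QP.2 // g_sym.
Qed.

Lemma gproj_ginv_ip u w : H Y w -> ip (gproj ip g H Y (ginv g Y u)) (g Y w) = ip u w.
Proof.
have [Q QP] := framed_represents; rewrite (represents_ginv _ MY fH QP) => Hw.
by rewrite QP.2.
Qed.

Lemma gproj_unique u v : H Y v -> (forall w, H Y w -> ip u (g Y w) = ip v (g Y w)) ->
  gproj ip g H Y u = v.
Proof.
move=> Hv uv; have [Q QP] := framed_represents; rewrite (gprojE _ MY fH QP).
by apply: (represents_eq MY fH QP) => // w Hw; rewrite -uv // g_sym.
Qed.

Lemma gproj_id v : H Y v -> gproj ip g H Y v = v.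
Proof. by move=> Hv; exact: gproj_unique. Qed.

Lemma gproj_ext u v : (forall w, H Y w -> ip u (g Y w) = ip v (g Y w)) ->
  gproj ip g H Y u = gproj ip g H Y v.
Proof.
move=> uv; apply: gproj_unique; first exact: gproj_in.
by move=> w Hw; rewrite gproj_ip // uv.
Qed.

Lemma gproj_ginv_ext u v : (forall w, H Y w -> ip u w = ip v w) ->
  gproj ip g H Y (ginv g Y u) = gproj ip g H Y (ginv g Y v).
Proof.
move=> uv; apply: gproj_unique; first exact: gproj_in.
by move=> w Hw; rewrite gproj_ginv_ip // -uv // -g_sym // gK.
Qed.

End Projection.

Lemma gproj_ginv_smooth_at H Y (F : E -> E) : M Y -> (forall Z, M Z -> framed_at H Z) ->
  (forall (U : set E) xi Z, open U -> smooth_at M Z xi ->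
     (forall Z', U Z' -> M Z' -> H Z' (xi Z')) ->
     U Z -> M Z -> smooth_at M Z (fun z => ip (F z) (xi z) : R)) ->
  smooth_at M Y (fun z => gproj ip g H z (ginv g z (F z))).
Proof.
move=> MY fH sF; have [U [Q [oU UY QP Qs]]] := framed_representative (fH Y MY).
apply: (smooth_at_eq oU UY (F := fun z => Q z (F z))).
  by move=> Z UZ MZ; rewrite (represents_ginv _ MZ (fH Z MZ) (QP Z UZ MZ)).
by apply: Qs => // xi Z sxi Hxi UZ MZ; apply: (sF U).
Qed.

Lemma smooth_at_g Y F : M Y -> smooth_at M Y F -> smooth_at M Y (fun z => g z (F z)).
Proof.
move=> MY sF; apply: (smooth_at_app norm_ip MY (ambient_retraction MY) (T := g)) => // u.
exact: smooth_g.
Qed.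

Lemma smooth_at_gproj_ginv H Y F : M Y -> (forall Z, M Z -> framed_at H Z) ->
  smooth_on M F -> smooth_at M Y (fun z => gproj ip g H z (ginv g z (F z))).
Proof.
move=> MY fH sF; apply: gproj_ginv_smooth_at => // U xi Z oU sxi _ UZ MZ.
by apply: (smooth_at_ip norm_ip MZ (ambient_retraction MZ)) => //; exact: sF.
Qed.

Lemma gproj_smooth H F : (forall Z, M Z -> framed_at H Z) ->
  smooth_on M F -> smooth_on M (fun z => gproj ip g H z (F z)).
Proof.
move=> fH sF Y MY.
apply: (smooth_at_eq openT I (F := fun z => gproj ip g H z (ginv g z (g z (F z))))).
  by move=> Z _ MZ; rewrite ginvK.
by apply: smooth_at_gproj_ginv => // Z MZ; apply: smooth_at_g => //; exact: sF.
Qed.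

Lemma framed_full Y : M Y -> framed_at (fun=> setT) Y.
Proof.
move=> MY; have bP := vbasisP (fullv : {vspace E}).
exists setT, (\dim (fullv : {vspace E})), (fun i _ => (vbasis fullv)`_i).
split=> //; first exact: openT.
- by move=> i Z _ MZ; apply: smooth_at_cst => //; exact: ambient_retraction.
- by move=> Z _ _; apply/freeP; exact: basis_free bP.
- move=> Z _ _; apply/seteqP; split=> // v _.
  by exists (fun i => coord (vbasis fullv) i v); exact: coord_vbasis (memvf v).
Qed.

(** For the trivial bundle with fiber [E] the projection is the identity, so [Pi g^-1] is [g^-1]. *)
Lemma ginv_smooth F : smooth_on M F -> smooth_on M (fun z => ginv g z (F z)).
Proof.
move=> sF Y MY.
apply: (smooth_at_eq openT I (F := fun z => gproj ip g (fun=> setT) z (ginv g z (F z)))).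
  by move=> Z _ MZ; apply: (gproj_id MZ) => //; exact: framed_full.
by apply: smooth_at_gproj_ginv => // Z MZ; exact: framed_full.
Qed.

Lemma subbundle_framed H Y : subbundle M H -> M Y -> framed_at H Y.
Proof.
move=> [_ [r fr]] MY; have [U [e [oU UY se He]]] := fr Y MY.
exists U, r, e; split=> //.
- move=> i Z UZ MZ; have [U' [G [oU' U'Z CG GE]]] := se i Z (conj MZ UZ).
  (* The extension [G] agrees with [e i] only on [M] intersected with [U]. *)
  exists (U `&` U'), G; split=> //; first exact: openI.
  + by move=> k; apply: Ck_sub (CG k) => z [].
  + by move=> z [Uz U'z] Mz; apply: GE.
- move=> Z UZ MZ; have [/freeP fe _] := He Z MZ UZ => a a0; apply: fe.
  rewrite -[RHS]a0; apply: eq_bigr => i _.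
  by rewrite (nth_map i) ?size_enum_ord // nth_ord_enum.
- move=> Z UZ MZ; have [_ ->] := He Z MZ UZ; apply/seteqP; split=> v /=.
    move=> /(@coord_span _ _ _ [tuple e i Z | i < r]) vE.
    exists (fun i => coord [tuple e i Z | i < r] i v); apply: (etrans vE).
    apply: eq_bigr => i _.
    by rewrite (nth_map i) ?size_enum_ord // nth_ord_enum.
  move=> [a ->]; apply: memv_suml => i _; apply: memvZ; apply: memv_span.
  by apply/mapP; exists i => //; rewrite mem_enum.
Qed.

Lemma tangent_framed Y : M Y -> framed_at (tangent M) Y.
Proof.
move=> MY; have [U [r [e [rU UY Ce He]]]] :=
  submanifold_frame norm_ip (ambient_manifold hA) MY.
have [oU _ _ rK] := rU.
exists U, d, e; split=> //.
- move=> i Z UZ MZ; have [U' [oU' U'Z CU']] := Ce i Z UZ.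
  by exists U', (e i).
- move=> Z UZ MZ; have [/freeP fe _] := He Z UZ MZ => a a0; apply: fe.
  rewrite -[RHS]a0; apply: eq_bigr => i _.
  by rewrite (nth_map i) ?size_enum_ord // nth_ord_enum.
- move=> Z UZ MZ; have [_ tE] := He Z UZ MZ.
  by apply/seteqP; split=> v /tE.
Qed.

End Frames.

(** * The Levi-Civita connection *)

Section Ambient.
Context {R : realType} {E : normedVectType R} (ip : {dot E for idfun}).
Variables (d : nat) (M : set E) (g : E -> 'End(E)).
Hypothesis hA : ambient_structure ip d M g.
Implicit Types (W : normedModType R) (Y : E).

Let norm_ip := ambient_norm hA.
Let smooth_g := ambient_smooth hA.
Let g_sym := ambient_selfadjoint hA.

Local Notation T := (tangent M).

Local Notation tanF := (tangent_framed hA).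
Local Notation retM := (ambient_retraction hA).

Lemma smooth_on_ip F G : smooth_on M F -> smooth_on M G ->
  smooth_on M (fun Z => ip (F Z) (G Z) : R).
Proof.
move=> sF sG Y MY.
by apply: (smooth_at_ip norm_ip MY (retM MY)); [exact: sF|exact: sG].
Qed.

Lemma smooth_on_cst W (w : W) : smooth_on M (fun=> w).
Proof. by move=> Y MY; exact: (smooth_at_cst norm_ip MY (retM MY) w). Qed.

Lemma smooth_on_dif W (F : E -> W) Y : M Y -> smooth_on M F -> dif_at M Y F.
Proof. by move=> MY sF; apply: smooth_dif; exact: sF. Qed.

(** The tangent projection of the constant field [v] is a vector field through [v]; this turns
    identities for fields into identities for tangent vectors. *)
Lemma extend_vector Y v : M Y -> T Y v -> exists xi, vector_field M xi /\ xi Y = v.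
Proof.
move=> MY tv; exists (fun Z => gproj ip g T Z v); split; last first.
  by apply: (gproj_id hA MY) => //; exact: tanF.
split; last by move=> Z MZ; apply: (gproj_in hA MZ); exact: tanF.
apply: (gproj_smooth hA); first exact: tanF.
exact: smooth_on_cst.
Qed.

Lemma tangentB Y u v : M Y -> T Y u -> T Y v -> T Y (u - v).
Proof. by move=> MY; exact: (framedB MY (tanF MY)). Qed.

Lemma tangent_lin Y a u v : M Y -> T Y u -> T Y v -> T Y (a *: u + v).
Proof. by move=> MY; exact: (framed_subspace a MY (tanF MY)). Qed.

Lemma Dop_linear (S : E -> 'End(E)) Y w a u v :
  (forall u, smooth_on M (fun Z => S Z u)) -> M Y -> T Y w ->
  Dop M S Y w (a *: u + v) = a *: Dop M S Y w u + Dop M S Y w v.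
Proof.
move=> sS MY tw; rewrite /Dop; have rY := retM MY.
rewrite (Dalong_eq MY rY tw (F' := fun Z => a *: S Z u + S Z v)); first last.
- by move=> Z MZ; rewrite linearP.
- exact: smooth_on_dif (sS _).
have du := smooth_on_dif MY (sS u); have dv := smooth_on_dif MY (sS v).
have da := smooth_on_dif MY (smooth_on_cst a).
have dau : dif_at M Y (fun Z => a *: S Z u).
  apply: smooth_dif => //; apply: (smooth_atZ norm_ip MY rY); last exact: sS.
  exact: smooth_on_cst.
rewrite (DalongD MY rY tw dau dv) (Dalong_scale MY rY tw da du).
by rewrite (Dalong_cst MY rY tw) scale0r add0r.
Qed.

Lemma Dop_dir (S : E -> 'End(E)) Y a v w u :
  (forall u, smooth_on M (fun Z => S Z u)) -> M Y -> T Y v -> T Y w ->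
  Dop M S Y (a *: v + w) u = a *: Dop M S Y v u + Dop M S Y w u.
Proof.
move=> sS MY tv tw.
by rewrite /Dop (Dalong_dir norm_ip MY (retM MY)) //; exact: smooth_on_dif (sS u).
Qed.

Lemma Dop_leibniz (S : E -> 'End(E)) (F : E -> E) Y w :
  (forall u, smooth_on M (fun Z => S Z u)) -> dif_at M Y F -> M Y -> T Y w ->
  Dalong M (fun Z => S Z (F Z)) Y w = Dop M S Y w (F Y) + S Y (Dalong M F Y w).
Proof.
move=> sS dF MY tw; apply: (Dalong_app norm_ip MY (retM MY) tw (T := S)) => // u.
exact: smooth_on_dif (sS u).
Qed.

(** Self-adjointness of [g] is differentiated with [u] and [v] held constant. *)
Lemma Dop_sym Y w u v : M Y -> T Y w ->
  ip (Dop M g Y w u) v = ip u (Dop M g Y w v).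
Proof.
move=> MY tw; have rY := retM MY.
have D := smooth_on_dif MY (smooth_g _).
have C x := smooth_on_dif MY (smooth_on_cst x).
have := Dalong_ip norm_ip MY rY tw (D u) (C _ v).
rewrite (Dalong_cst MY rY tw) ip0r addr0 => <-.
have := Dalong_ip norm_ip MY rY tw (C _ u) (D v).
rewrite (Dalong_cst MY rY tw) ip0l add0r => <-.
apply: (Dalong_eq MY rY tw); last by move=> Z MZ; exact: g_sym.
apply: smooth_on_dif => //; apply: smooth_on_ip; first exact: smooth_g.
exact: smooth_on_cst.
Qed.

Lemma smooth_on_app (S : E -> 'End(E)) (F : E -> E) :
  (forall u, smooth_on M (fun Z => S Z u)) -> smooth_on M F ->
  smooth_on M (fun Z => S Z (F Z)).
Proof.
move=> sS sF Y MY; apply: (smooth_at_app norm_ip MY (retM MY) (T := S)).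
  by move=> u; exact: sS.
exact: sF.
Qed.

Lemma smooth_on_Dalong W (F : E -> W) xi : smooth_on M F -> vector_field M xi ->
  smooth_on M (fun Z => Dalong M F Z (xi Z)).
Proof.
move=> sF [sxi txi] Y MY.
apply: (smooth_at_Dalong norm_ip MY (retM MY) openT I); [|exact: sF|exact: sxi].
by move=> Z _; exact: txi.
Qed.

(** [Dop] freezes the argument [eta Z] during differentiation; the Leibniz rule rewrites it as
    [D (S eta) - S (D eta)], where nothing is frozen. *)
Lemma smooth_on_Dop (S : E -> 'End(E)) xi eta :
  (forall u, smooth_on M (fun Z => S Z u)) -> vector_field M xi -> smooth_on M eta ->
  smooth_on M (fun Z => Dop M S Z (xi Z) (eta Z)).
Proof.
move=> sS vxi seta Y MY.
apply: (smooth_at_eq openT I (F := fun Z => Dalong M (fun Z => S Z (eta Z)) Z (xi Z)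
    - S Z (Dalong M eta Z (xi Z)))).
  move=> Z _ MZ; rewrite Dop_leibniz ?addrK //; last exact: vxi.2.
  exact: smooth_on_dif.
apply: (smooth_atB norm_ip MY (retM MY)).
  by apply: smooth_on_Dalong => //; exact: smooth_on_app.
by apply: smooth_on_app => //; exact: smooth_on_Dalong.
Qed.

Lemma tangent_sum Y n (F : 'I_n -> E) : M Y -> (forall i, T Y (F i)) -> T Y (\sum_i F i).
Proof.
move=> MY TF; apply: big_ind => //; first exact: framed0 (tanF MY).
by move=> u v tu tv; rewrite -[u]scale1r; exact: tangent_lin.
Qed.

Lemma Dalong_sum W (F : E -> W) Y n (a : 'I_n -> R) (b : 'I_n -> E) :
  M Y -> dif_at M Y F -> (forall i, T Y (b i)) ->
  Dalong M F Y (\sum_i a i *: b i) = \sum_i a i *: Dalong M F Y (b i).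
Proof.
move=> MY dF tb; have [U [r [rU UY]]] := retM MY.
have /(dif_atP MY _ rU UY) D := dF.
have ts : T Y (\sum_i a i *: b i).
  apply: tangent_sum => // i; rewrite -[_ *: _]addr0; apply: tangent_lin => //.
  exact: framed0 (tanF MY).
rewrite (DalongE rU) // derive_linear_sum //; apply: eq_bigr => i _.
by rewrite (DalongE rU).
Qed.

Lemma ambient_form_ip X Y u v w : ambient_form ip M g X -> M Y -> T Y u -> T Y v -> T Y w ->
  ip (X Y u v) w = ip u (Dop M g Y w v).
Proof.
move=> fX MY tu tv tw.
have [xi [vxi <-]] := extend_vector MY tu.
have [eta [veta <-]] := extend_vector MY tv.
have [zeta [vzeta <-]] := extend_vector MY tw.
exact: (form_adjoint fX).
Qed.

Lemma ambient_form_exists : exists X : E -> E -> E -> E,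
  [/\ ambient_form ip M g X, tangent_valued M X &
      forall xi eta, vector_field M xi -> vector_field M eta ->
        smooth_on M (fun Y => X Y (xi Y) (eta Y))].
Proof.
have [n [b [w bw]]] := dual_family ip.
(* With the identity as metric operator, the projection results give the [ip]-orthogonal projection
   [P] onto tangent spaces, smooth in the base point. *)
pose g1 : E -> 'End(E) := fun=> \1%VF.
have h1 : ambient_structure ip d M g1.
  split=> //; first exact: ambient_manifold hA.
  - by move=> u; exact: (smooth_on_cst ((\1%VF : 'End(E)) u)).
  - by move=> Y _ u v; rewrite !id_lfunE.
  - by move=> Y _ u u0; rewrite id_lfunE; exact: neq0_dnorm_gt0.
pose P := gproj ip g1 T.
have PT Y u : M Y -> T Y (P Y u).
  by move=> MY; apply: (gproj_in h1 MY); exact: tanF.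
have Pip Y u t : M Y -> T Y t -> ip (P Y u) t = ip u t.
  move=> MY tt; have := gproj_ip h1 MY (tanF MY) u tt.
  by rewrite id_lfunE.
have Pvf u : vector_field M (fun Z => P Z u).
  split=> [|Z MZ]; last exact: PT.
  apply: (gproj_smooth h1); first exact: tanF.
  exact: smooth_on_cst.
(* The Riesz representative in [T Y] of [t -> ip u ((D_t g) v)]: a tangent [t] is the sum of the
   [ip t (w j) *: P Y (b j)], and the derivative is linear in its direction. *)
pose X Y u v := \sum_j ip u (Dop M g Y (P Y (b j)) v) *: P Y (w j).
have XE Y u v t : M Y -> T Y t -> ip (X Y u v) t = ip u (Dop M g Y t v).
  move=> MY tt; rewrite ip_suml.
  have tE : t = \sum_j ip t (w j) *: P Y (b j).
    rewrite -[LHS](gproj_id h1 MY (tanF MY) tt) {1}(bw t) linear_sum.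
    by apply: eq_bigr => j _; rewrite linearZ.
  rewrite [in RHS]tE /Dop Dalong_sum //; last 2 first.
  - exact: smooth_on_dif (smooth_g _).
  - by move=> i; exact: PT.
  rewrite (ipC _ u) ip_suml; apply: eq_bigr => j _.
  by rewrite !ipZl Pip // mulrC (ipC _ u) (ipC _ (w j)).
exists X; split.
- split.
  + move=> Y MY a u u' v tu tu' tv; rewrite /X scaler_sumr -big_split.
    by apply: eq_bigr => j _ /=; rewrite ipDl ipZl scalerDl scalerA.
  + move=> Y MY a u v v' tu tv tv'; rewrite /X scaler_sumr -big_split.
    apply: eq_bigr => j _ /=; rewrite Dop_linear //; last exact: PT.
    by rewrite ipDr ipZr scalerDl scalerA.
  + by move=> xi eta xi0 vxi veta [_ vxi0] Y MY; rewrite XE //; exact: vxi0.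
- move=> xi eta vxi veta Y MY; apply: tangent_sum => // j.
  by rewrite -[_ *: _]addr0; apply: tangent_lin => //; [exact: PT|exact: framed0 (tanF MY)].
- move=> xi eta vxi veta Y MY.
  apply: (smooth_at_sum norm_ip MY (retM MY)
    (F := fun j Z => ip (xi Z) (Dop M g Z (P Z (b j)) (eta Z)) *: P Z (w j))) => j.
  apply: (smooth_atZ norm_ip MY (retM MY)); last exact: (Pvf _).1.
  apply: smooth_on_ip MY; first exact: vxi.1.
  by apply: smooth_on_Dop => //; exact: veta.1.
Qed.

End Ambient.

(** * The Koszul expression and smoothness of nabla *)

Section LeviCivita.
Context {R : realType} {E : normedVectType R} (ip : {dot E for idfun}).
Variables (d : nat) (M : set E) (g : E -> 'End(E)).
Hypothesis hA : ambient_structure ip d M g.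
Implicit Types (W : normedModType R) (Y : E).

Let norm_ip := ambient_norm hA.
Let smooth_g := ambient_smooth hA.
Let g_sym := ambient_selfadjoint hA.
Local Notation T := (tangent M).
Local Notation tanF := (tangent_framed hA).
Local Notation retM := (ambient_retraction hA).

(* The Koszul expression: the pairing of K(u, v) with the tangent vector w,
   where X(u, v) has been eliminated by its defining property. *)
Definition koszul Y u v w : R :=
  2^-1 * (ip (Dop M g Y u v) w + ip (Dop M g Y v u) w - ip u (Dop M g Y w v)).

Lemma Kform_ip X xi eta Y w : ambient_form ip M g X ->
  M Y -> T Y (xi Y) -> T Y (eta Y) -> T Y w ->
  ip (Kform M g X xi eta Y) w = koszul Y (xi Y) (eta Y) w.
Proof.
by move=> fX MY tx te tw; rewrite /Kform ipZl !ipDl ipNl (ambient_form_ip hA fX MY).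
Qed.

Lemma ambient_nabla_tangent X xi eta Y : M Y ->
  T Y (ambient_nabla ip M g X xi eta Y).
Proof. by move=> MY; exact: (gproj_in hA MY (tanF MY)). Qed.

Lemma ambient_nabla_ip X xi eta Y w : ambient_form ip M g X ->
  M Y -> T Y (xi Y) -> T Y (eta Y) -> T Y w ->
  ip (ambient_nabla ip M g X xi eta Y) (g Y w) =
  ip (Dalong M eta Y (xi Y)) (g Y w) + koszul Y (xi Y) (eta Y) w.
Proof.
move=> fX MY tx te tw; rewrite (gproj_ip hA MY (tanF MY) _ tw) ipDl.
by rewrite -(Kform_ip fX MY tx te tw) -[in X in _ + X](g_sym MY) (gK hA).
Qed.

Lemma ambient_nabla_unique X xi eta Y v : ambient_form ip M g X ->
  M Y -> T Y (xi Y) -> T Y (eta Y) -> T Y v ->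
  (forall w, T Y w -> ip v (g Y w) =
     ip (Dalong M eta Y (xi Y)) (g Y w) + koszul Y (xi Y) (eta Y) w) ->
  ambient_nabla ip M g X xi eta Y = v.
Proof.
move=> fX MY tx te tv vE; apply: (gproj_unique hA MY (tanF MY) tv) => w tw.
by rewrite vE // -(ambient_nabla_ip fX) // (gproj_ip hA MY (tanF MY)).
Qed.

Lemma ambient_nabla_form X1 X2 xi eta Y :
  ambient_form ip M g X1 -> ambient_form ip M g X2 ->
  M Y -> T Y (xi Y) -> T Y (eta Y) ->
  ambient_nabla ip M g X1 xi eta Y = ambient_nabla ip M g X2 xi eta Y.
Proof.
move=> f1 f2 MY tx te; apply: ambient_nabla_unique => //.
  exact: ambient_nabla_tangent.
by move=> w tw; exact: ambient_nabla_ip.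
Qed.

Lemma vector_field_eq xi xi' : vector_field M xi ->
  (forall Y, M Y -> xi Y = xi' Y) -> vector_field M xi'.
Proof.
move=> [sxi txi] xx; split=> Y MY; last by rewrite -xx //; exact: txi.
by apply: (smooth_at_eq openT I (F := xi)) (sxi Y MY) => Z _; exact: xx.
Qed.

Lemma ambient_nabla_field X xi eta : ambient_form ip M g X ->
  vector_field M xi -> vector_field M eta ->
  vector_field M (ambient_nabla ip M g X xi eta).
Proof.
(* [X] is exchanged for a form [X1] that takes smooth fields to smooth functions; on [M] both define
   the same nabla. *)
move=> fX vxi veta; have [X1 [f1 _ sX1]] := ambient_form_exists hA.
apply: (@vector_field_eq (ambient_nabla ip M g X1 xi eta)); last first.
  by move=> Y MY; apply: ambient_nabla_form => //; [exact: vxi.2|exact: veta.2].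
split; last by move=> Y MY; exact: ambient_nabla_tangent.
apply: (gproj_smooth hA); first by move=> Z MZ; exact: tanF.
have sD := smooth_on_Dalong hA veta.1 vxi.
have s1 := smooth_on_Dop hA smooth_g vxi veta.1.
have s2 := smooth_on_Dop hA smooth_g veta vxi.1.
have s3 := sX1 xi eta vxi veta.
have sK : smooth_on M (Kform M g X1 xi eta).
  move=> Y MY; have rY := retM MY.
  apply: (smooth_atZ norm_ip MY rY); first exact: (smooth_on_cst hA (2^-1 : R) MY).
  apply: (smooth_atB norm_ip MY rY); last exact: s3.
  by apply: (smooth_atD norm_ip MY rY); [exact: s1|exact: s2].
move=> Y MY; apply: (smooth_atD norm_ip MY (retM MY)); first exact: sD.
exact: (ginv_smooth hA sK).
Qed.

Lemma half_sum_linear (a A B C A' B' C' : R) :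
  2^-1 * (a * A + A' + (a * B + B') - (a * C + C')) =
  a * (2^-1 * (A + B - C)) + 2^-1 * (A' + B' - C').
Proof. ring. Qed.

Lemma koszulDl Y a u u' v w : M Y -> T Y u -> T Y u' -> T Y v -> T Y w ->
  koszul Y (a *: u + u') v w = a * koszul Y u v w + koszul Y u' v w.
Proof.
move=> MY tu tu' tv tw; rewrite /koszul -half_sum_linear.
by rewrite (Dop_dir hA _ _ smooth_g MY tu tu') (Dop_linear hA _ _ _ smooth_g MY tv)
  !ipDl !ipZl.
Qed.

Lemma koszulDr Y a u v v' w : M Y -> T Y u -> T Y v -> T Y v' -> T Y w ->
  koszul Y u (a *: v + v') w = a * koszul Y u v w + koszul Y u v' w.
Proof.
move=> MY tu tv tv' tw; rewrite /koszul -half_sum_linear.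
by rewrite (Dop_dir hA _ _ smooth_g MY tv tv') !(Dop_linear hA _ _ _ smooth_g MY) //
  !ipDl !ipZl !ipDr !ipZr.
Qed.

(** Rests on self-adjointness of [D_w g], and is what makes nabla torsion-free. *)
Lemma koszul_sym Y u v w : M Y -> T Y w -> koszul Y u v w = koszul Y v u w.
Proof.
move=> MY tw; rewrite /koszul -(Dop_sym hA _ _ MY tw) [ip (Dop M g Y w u) v]ipC.
by rewrite [X in X - _]addrC.
Qed.

End LeviCivita.

(** * Connection axioms, torsion, metric compatibility and uniqueness *)

Section Connection.
Context {R : realType} {E : normedVectType R} (ip : {dot E for idfun}).
Variables (d : nat) (M : set E) (g : E -> 'End(E)).
Hypothesis hA : ambient_structure ip d M g.
Implicit Types (W : normedModType R) (Y : E).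

Let norm_ip := ambient_norm hA.
Let smooth_g := ambient_smooth hA.
Let g_sym := ambient_selfadjoint hA.
Local Notation T := (tangent M).
Local Notation tanF := (tangent_framed hA).
Local Notation retM := (ambient_retraction hA).

Lemma vector_field_lin (a : E -> R) xi xi' : smooth_on M a ->
  vector_field M xi -> vector_field M xi' ->
  vector_field M (fun Z => a Z *: xi Z + xi' Z).
Proof.
move=> sa [sxi txi] [sxi' txi']; split=> Y MY.
  apply: (smooth_atD norm_ip MY (retM MY)); last exact: sxi'.
  by apply: (smooth_atZ norm_ip MY (retM MY)); [exact: sa|exact: sxi].
by apply: (tangent_lin hA _ MY); [exact: txi|exact: txi'].
Qed.

Lemma vector_fieldZ (a : E -> R) xi : smooth_on M a ->
  vector_field M xi -> vector_field M (fun Z => a Z *: xi Z).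
Proof.
move=> sa [sxi txi]; split=> Y MY.
  by apply: (smooth_atZ norm_ip MY (retM MY)); [exact: sa|exact: sxi].
rewrite -[_ *: _]addr0; apply: (tangent_lin hA _ MY); first exact: txi.
exact: (framed0 MY (tanF MY)).
Qed.

Lemma vector_fieldD xi xi' :
  vector_field M xi -> vector_field M xi' ->
  vector_field M (fun Z => xi Z + xi' Z).
Proof.
move=> vxi vxi'; apply: (vector_field_eq (xi := fun Z => 1 *: xi Z + xi' Z)).
  by apply: vector_field_lin => //; exact: (smooth_on_cst hA (1 : R)).
by move=> Y _; rewrite scale1r.
Qed.

Lemma vector_fieldB xi xi' :
  vector_field M xi -> vector_field M xi' ->
  vector_field M (fun Z => xi Z - xi' Z).
Proof.
move=> vxi vxi'; apply: (vector_field_eq (xi := fun Z => -1 *: xi' Z + xi Z)).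
  by apply: vector_field_lin => //; exact: (smooth_on_cst hA (-1 : R)).
by move=> Y _; rewrite scaleN1r addrC.
Qed.

(** Each axiom is checked by pairing: the proposed value is tangent and has the pairings with [g w]
    that characterize nabla. *)
Lemma ambient_nabla_connection X : ambient_form ip M g X ->
  affine_connection M (ambient_nabla ip M g X).
Proof.
move=> fX; split.
- by move=> xi eta vxi veta; exact: (ambient_nabla_field hA).
- move=> xi xi' eta eta' vxi vxi' veta veta' xx ee Y MY.
  apply: (ambient_nabla_unique hA fX MY (vxi.2 Y MY) (veta.2 Y MY)).
    exact: (ambient_nabla_tangent hA).
  move=> w tw.
  rewrite (ambient_nabla_ip hA fX MY (vxi'.2 Y MY) (veta'.2 Y MY) tw) xx // ee //.
  rewrite -(Dalong_eq MY (retM MY) (vxi'.2 Y MY) _ ee) //.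
  exact: smooth_on_dif MY veta.1.
- move=> a xi xi' eta sa vxi vxi' veta Y MY.
  have tx := vxi.2 Y MY; have tx' := vxi'.2 Y MY; have te := veta.2 Y MY.
  apply: (ambient_nabla_unique hA fX MY) => //.
  + exact: (vector_field_lin sa vxi vxi').2.
  + by apply: (tangent_lin hA _ MY); exact: (ambient_nabla_tangent hA).
  move=> w tw; rewrite (Dalong_dir norm_ip MY (retM MY) tx) //; last first.
    exact: smooth_on_dif MY veta.1.
  rewrite ipDl ipZl !(ambient_nabla_ip hA fX MY) // ipDl ipZl.
  by rewrite (koszulDl hA _ MY) // mulrDr addrACA.
- move=> xi eta eta' vxi veta veta' Y MY.
  have tx := vxi.2 Y MY; have te := veta.2 Y MY; have te' := veta'.2 Y MY.
  apply: (ambient_nabla_unique hA fX MY) => //.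
  + exact: (vector_fieldD veta veta').2.
  + rewrite -[X in X + _]scale1r.
    by apply: (tangent_lin hA _ MY); exact: (ambient_nabla_tangent hA).
  move=> w tw; rewrite (DalongD MY (retM MY) tx); last 2 first.
    exact: smooth_on_dif MY veta.1.
    exact: smooth_on_dif MY veta'.1.
  rewrite ipDl !(ambient_nabla_ip hA fX MY) // ipDl.
  by rewrite -[eta Y]scale1r (koszulDr hA _ MY) // mul1r scale1r addrACA.
- move=> a xi eta sa vxi veta Y MY.
  have tx := vxi.2 Y MY; have te := veta.2 Y MY.
  apply: (ambient_nabla_unique hA fX MY) => //.
  + exact: (vector_fieldZ sa veta).2.
  + apply: (tangent_lin hA _ MY) => //; rewrite -[_ *: _]addr0.
    apply: (tangent_lin hA _ MY); first exact: (ambient_nabla_tangent hA).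
    exact: (framed0 MY (tanF MY)).
  move=> w tw; rewrite (Dalong_scale MY (retM MY) tx); last 2 first.
    exact: smooth_on_dif MY sa.
    exact: smooth_on_dif MY veta.1.
  rewrite !ipDl !ipZl (ambient_nabla_ip hA fX MY) // mulrDr addrA.
  congr (_ + _).
  have t0 := framed0 MY (tanF MY).
  (* Additivity at [0 = 0 + 0]. *)
  have k0 : koszul ip M g Y (xi Y) 0 w = 0.
    have := koszulDr hA 1 MY tx t0 t0 tw.
    by rewrite scaler0 addr0 mul1r => /eqP; rewrite -subr_eq subrr => /eqP.
  by rewrite -[a Y *: eta Y]addr0 (koszulDr hA _ MY) // k0 addr0.
Qed.

(** Any differentiable extension [G] computes the derivative: [F o r = G o r] near [Y], and [dr]
    fixes the tangent vector [v]. *)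
Lemma Dalong_extension W (F G : E -> W) (U : set E) Y v :
  M Y -> T Y v -> open U -> U Y -> differentiable G Y ->
  (forall Z, U Z -> M Z -> G Z = F Z) -> Dalong M F Y v = 'D_v G Y.
Proof.
move=> MY tv oU UY dG GF; have [U' [r [rU' U'Y]]] := retM MY.
have [oU' Cr rM rK] := rU'.
have dF : dif_at M Y F by exists U, G.
rewrite (DalongE rU') //; last by apply/(dif_atP MY _ rU' U'Y).
have dr := Cinf_at_diff (retraction_Cinf_at rU' U'Y).
have cr : {for Y, continuous r} by exact: differentiable_continuous.
have nU : \forall z \near Y, U (r z).
  by apply: cr; rewrite rK //; exact: open_nbhs_nbhs.
rewrite (near_eq_derive (g := G \o r)); last first.
  apply: filterS2 nU (open_near oU' U'Y (fun z Uz => Uz)) => z Uz U'z /=.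
  by rewrite GF //; exact: rM.
rewrite derive_comp ?rK //.
by move: tv => /(tangentP norm_ip _ rU' U'Y MY) ->.
Qed.

(** The Leibniz rule for the operator-valued function [z -> 'd A z] applied to [F z]. *)
Lemma derive_along_field (A : E -> R) (F : E -> E) x v :
  Cinf_at x A -> differentiable F x ->
  'D_v (fun z => 'D_(F z) A z) x = 'D_v (fun z => 'D_(F x) A z) x + 'D_('D_v F x) A x.
Proof.
move=> CA dF; have nd := Cinf_at_near CA.
have nE (G : E -> E) :
    \forall z \near x, 'D_(G z) A z = ('d A z : {linear E -> R}) (G z).
  by apply: filterS nd => z /Cinf_at_diff dA; rewrite deriveE.
rewrite (near_eq_derive _ (nE F)) (near_eq_derive _ (nE (fun=> F x))).
rewrite (derive_app norm_ip _ (T := fun z => 'd A z)) //.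
  by congr (_ + _); rewrite [RHS]deriveE //; exact: Cinf_at_diff.
move=> u; have [B [oB Bx BE]] := near_open (nE (fun=> u)).
apply: (diff_eq_open oB Bx BE).
exact/Cinf_at_diff/Cinf_at_derive.
Qed.

(** The second derivatives cancel by [schwarz], leaving the derivative along the bracket. It is
    taken of [a o r] in [E] because tangency of the bracket is not yet known: it is deduced from
    this formula. *)
Lemma Dalong_commutator (a : E -> R) xi eta Y U r :
  smooth_on M a -> vector_field M xi -> vector_field M eta -> M Y ->
  retraction M U r -> U Y ->
  Dalong M (fun Z => Dalong M a Z (eta Z)) Y (xi Y)
  - Dalong M (fun Z => Dalong M a Z (xi Z)) Y (eta Y) =
  'D_(Dalong M eta Y (xi Y) - Dalong M xi Y (eta Y)) (a \o r) Y.
Proof.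
move=> sa vxi veta MY rU UY.
have CA : Cinf_at Y (a \o r) by apply/(smooth_atP norm_ip _ rU UY MY); exact: sa.
have rY : r Y = Y by have [_ _ _ rK] := rU; exact: rK.
have [U1 [oU1 U1Y C1]] := CA.
have D zeta theta : vector_field M zeta -> vector_field M theta ->
    Dalong M (fun Z => Dalong M a Z (theta Z)) Y (zeta Y) =
    'D_(zeta Y) (fun z => 'D_(theta Y) (a \o r) z) Y
    + 'D_(Dalong M theta Y (zeta Y)) (a \o r) Y.
  move=> vz vt.
  have Ct : Cinf_at Y (theta \o r) by apply/(smooth_atP norm_ip _ rU UY MY); exact: vt.1.
  have dt := Cinf_at_diff Ct.
  rewrite (DalongE rU (F := theta) UY MY (vz.2 Y MY) dt).
  have := derive_along_field (zeta Y) CA dt; rewrite [(theta \o r) Y]/= rY => <-.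
  have [oU _ _ rK] := rU.
  apply: (@Dalong_extension _ _ _ (U `&` U1)) => //.
  - exact: vz.2.
  - exact: openI.
  - apply: Cinf_at_diff; apply: Cinf_at_Derive => //.
    exact: has_coordinates_fd norm_ip.
  - move=> Z [UZ U1Z] MZ; rewrite (DalongE rU) //= ?rK //; first exact: vt.2.
    exact: Ck_diff (C1 1%N) U1Z.
rewrite (D xi eta) // (D eta xi) //.
rewrite (schwarz (xi Y) (eta Y) oU1 U1Y (C1 2)) opprD addrACA subrr add0r.
by rewrite !deriveE ?linearB //; exact: Cinf_at_diff.
Qed.

Lemma Dalong_ipl Y w v : M Y -> T Y v -> Dalong M (ipl ip w) Y v = ip v w.
Proof.
move=> MY tv; rewrite (@Dalong_extension _ _ (ipl ip w) setT) //.
- by rewrite derive_lin //; exact: ipl_continuous.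
- exact: openT.
- by apply: linear_differentiable; exact: ipl_continuous.
Qed.

Lemma smooth_ipl w : smooth_on M (ipl ip w).
Proof.
move=> Y MY; exists setT, (ipl ip w); split=> //; first exact: openT.
by move=> k; apply: Ck_lin; exact: ipl_continuous.
Qed.

Lemma Dalong_ipl_field Y w xi eta : M Y -> vector_field M xi -> vector_field M eta ->
  Dalong M (fun Z => Dalong M (ipl ip w) Z (eta Z)) Y (xi Y) =
  ip (Dalong M eta Y (xi Y)) w.
Proof.
move=> MY vxi veta; have rY := retM MY; have tx := vxi.2 Y MY.
have sw := smooth_on_cst hA w.
rewrite -(Dalong_eq MY rY tx (F := fun Z => ip (eta Z) w : R)); first last.
- by move=> Z MZ; rewrite Dalong_ipl //; exact: veta.2.
- by apply: (smooth_on_dif MY); apply: (smooth_on_ip hA) => //; exact: veta.1.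
rewrite (Dalong_ip norm_ip MY rY tx).
- by rewrite (Dalong_cst MY rY tx) ip0r addr0.
- exact: smooth_on_dif MY veta.1.
- exact: smooth_on_dif MY sw.
Qed.

(** For the linear functions [ipl ip w] the commutator formula says that the bracket and its image
    under [dr] have the same pairing with every [w]; so [dr] fixes the bracket. *)
Lemma bracket_tangent Y xi eta : M Y -> vector_field M xi -> vector_field M eta ->
  T Y (Dalong M eta Y (xi Y) - Dalong M xi Y (eta Y)).
Proof.
move=> MY vxi veta; have [U [r [rU UY]]] := retM MY.
apply/(tangentP norm_ip _ rU UY MY); apply: (ip_inj (ip := ip)) => w.
have dr := Cinf_at_diff (retraction_Cinf_at rU UY).
have cl := @ipl_continuous _ _ ip norm_ip w.
have := Dalong_commutator (smooth_ipl w) vxi veta MY rU UY.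
rewrite !Dalong_ipl_field // -[X in 'D_ _ X Y]/(fun z => ipl ip w (r z)).
by rewrite derive_linear_comp //= ipBl => <-.
Qed.

(** The Koszul terms cancel by symmetry, and the remaining bracket is tangent, hence unchanged by
    the projection. *)
Lemma ambient_nabla_bracket X xi eta Y : ambient_form ip M g X -> M Y ->
  vector_field M xi -> vector_field M eta ->
  ambient_nabla ip M g X xi eta Y - ambient_nabla ip M g X eta xi Y =
  Dalong M eta Y (xi Y) - Dalong M xi Y (eta Y).
Proof.
move=> fX MY vxi veta; have tx := vxi.2 Y MY; have te := veta.2 Y MY.
apply/eqP; rewrite subr_eq; apply/eqP.
apply: (ambient_nabla_unique hA fX MY) => //.
  rewrite -[X in X + _]scale1r; apply: (tangent_lin hA _ MY).
    exact: bracket_tangent.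
  exact: (ambient_nabla_tangent hA).
move=> w tw; rewrite ipDl ipBl (ambient_nabla_ip hA fX MY) //.
by rewrite (koszul_sym hA (eta Y) (xi Y) MY tw) addrA subrK.
Qed.

Lemma ambient_nabla_torsion_free X : ambient_form ip M g X ->
  torsion_free M (ambient_nabla ip M g X).
Proof.
move=> fX xi eta a vxi veta sa Y MY; have [U [r [rU UY]]] := retM MY.
rewrite (Dalong_commutator sa vxi veta MY rU UY) ambient_nabla_bracket //.
apply: (DalongE rU) => //; first exact: bracket_tangent.
by apply: Cinf_at_diff; apply/(smooth_atP norm_ip _ rU UY MY); exact: sa.
Qed.

Lemma half_sum_cancel (A B C : R) : 2^-1 * (A + B - C) + 2^-1 * (A + C - B) = A.
Proof. lra. Qed.

(** The source of metric compatibility: the derivatives of [g] along [v] and [w] cancel. *)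
Lemma koszul_skew Y u v w : M Y -> T Y u -> T Y v -> T Y w ->
  koszul ip M g Y u v w + koszul ip M g Y u w v = ip (Dop M g Y u v) w.
Proof.
move=> MY tu tv tw; rewrite /koszul.
rewrite (Dop_sym hA u w MY tv) (Dop_sym hA u v MY tw) (Dop_sym hA w v MY tu).
by rewrite (ipC _ w) half_sum_cancel.
Qed.

Lemma ambient_nabla_metric X : ambient_form ip M g X ->
  metric_compatible ip M g (ambient_nabla ip M g X).
Proof.
move=> fX zeta xi eta vz vxi veta Y MY; rewrite /rmetric.
have tz := vz.2 Y MY; have tx := vxi.2 Y MY; have te := veta.2 Y MY.
have rY := retM MY; have de := smooth_on_dif MY veta.1.
have gC u v : ip u (g Y v) = ip v (g Y u) by rewrite -g_sym // ipC.
rewrite (Dalong_ip norm_ip MY rY tz); last 2 first.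
- exact: smooth_on_dif MY vxi.1.
- by apply: (smooth_on_dif MY); apply: (smooth_on_app hA) => //; exact: veta.1.
rewrite (Dop_leibniz hA smooth_g de MY tz) ipDr (gC (xi Y)).
rewrite [ip (xi Y) (g Y (ambient_nabla _ _ _ _ _ _ _))]gC.
rewrite !(ambient_nabla_ip hA fX MY) // addrACA koszul_skew //.
by rewrite (Dop_sym hA (xi Y) (eta Y) MY tz) -addrA [X in _ + X]addrC.
Qed.

Lemma ambient_nabla_levi_civita X : ambient_form ip M g X ->
  levi_civita ip M g (ambient_nabla ip M g X).
Proof.
move=> fX; split; first exact: ambient_nabla_connection.
- exact: ambient_nabla_torsion_free.
- exact: ambient_nabla_metric.
Qed.

(** Torsion-freeness is stated through derivatives of functions; the linear functions [ipl ip w]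
    turn it into an identity of vectors. *)
Lemma levi_civita_torsion nabla xi eta Y : levi_civita ip M g nabla -> M Y ->
  vector_field M xi -> vector_field M eta ->
  nabla xi eta Y - nabla eta xi Y = Dalong M eta Y (xi Y) - Dalong M xi Y (eta Y).
Proof.
move=> [cn tn _] MY vxi veta; apply: (ip_inj (ip := ip)) => w.
have tt : T Y (nabla xi eta Y - nabla eta xi Y).
  by apply: (tangentB hA MY); apply: (conn_field cn _ _).2.
have := tn xi eta (ipl ip w) vxi veta (smooth_ipl w) Y MY.
by rewrite !Dalong_ipl_field // Dalong_ipl // => ->; rewrite ipBl.
Qed.

(* The difference S of two such connections is symmetric and skew for the
   metric in its last two slots; the two together force S = 0. *)
Lemma levi_civita_unique nabla nabla' xi eta Y :
  levi_civita ip M g nabla -> levi_civita ip M g nabla' ->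
  vector_field M xi -> vector_field M eta -> M Y ->
  nabla xi eta Y = nabla' xi eta Y.
Proof.
move=> ln ln' vxi veta MY; have [cn _ mn] := ln; have [cn' _ mn'] := ln'.
pose S a b Z := nabla a b Z - nabla' a b Z.
have vS a b : vector_field M a -> vector_field M b -> vector_field M (S a b).
  by move=> va vb; apply: vector_fieldB; apply: conn_field.
have SC a b : vector_field M a -> vector_field M b -> S a b Y = S b a Y.
  move=> va vb; have tE : nabla a b Y - nabla b a Y = nabla' a b Y - nabla' b a Y.
    by rewrite !levi_civita_torsion.
  apply/eqP; rewrite /S subr_eq -(subrK (nabla b a Y) (nabla a b Y)) tE.
  by rewrite [X in X == _]addrC addrA addrAC.
have Sm a b c : vector_field M a -> vector_field M b -> vector_field M c ->
    ip (S a b Y) (g Y (c Y)) = - ip (S a c Y) (g Y (b Y)).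
  move=> va vb vc.
  have gC u v : ip u (g Y v) = ip v (g Y u) by rewrite -g_sym // ipC.
  have := mn' a b c va vb vc Y MY; rewrite (mn a b c va vb vc Y MY) /rmetric.
  rewrite [ip (b Y) (g Y (nabla _ _ _))]gC [ip (b Y) (g Y (nabla' _ _ _))]gC => nE.
  rewrite /S !ipBl opprB; apply/eqP; rewrite subr_eq addrAC -subr_eq opprK.
  by rewrite nE addrC.
have vs := vS _ _ vxi veta.
pose s := S xi eta.
(* The field [s] serves as third argument. Three skew moves and three symmetric moves, taken
   alternately, return to the initial expression with the sign changed. *)
have k : ip (S xi eta Y) (g Y (s Y)) = - ip (S xi eta Y) (g Y (s Y)).
  rewrite {1}Sm // (SC xi s) // (Sm s xi eta) // (SC s eta) // (Sm eta s xi) //.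
  by rewrite (SC eta xi) // opprK.
apply/eqP; rewrite -subr_eq0; apply/eqP/(metric_eq0 hA MY).
by move: k; rewrite /s /S; set x := ip _ _ => k; lra.
Qed.

End Connection.

(** * Riemannian Hessians *)

Section Hessian.
Context {R : realType} {E : normedVectType R} (ip : {dot E for idfun}).
Variables (d : nat) (M : set E) (g : E -> 'End(E)).
Hypothesis hA : ambient_structure ip d M g.
Implicit Types (W : normedModType R) (Y : E).

Let norm_ip := ambient_norm hA.
Let smooth_g := ambient_smooth hA.
Let g_sym := ambient_selfadjoint hA.
Local Notation T := (tangent M).
Local Notation tanF := (tangent_framed hA).
Local Notation retM := (ambient_retraction hA).

Section Subbundle.
Variable H : E -> set E.
Hypotheses (framedH : forall Y, M Y -> framed_at M H Y)
  (HT : forall Y, M Y -> H Y `<=` T Y).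
Local Notation P := (gproj ip g H).

Lemma section_field xi : is_section M H xi -> vector_field M xi.
Proof. by move=> [sxi Hxi]; split=> // Y MY; exact/HT/Hxi. Qed.

Lemma smooth_gproj u : smooth_on M (fun Z => P Z u).
Proof. by apply: (gproj_smooth hA framedH); exact: (smooth_on_cst hA). Qed.

(** As [H] lies in [T], the vectors tested by [P] are also tested by the tangent projection; this
    removes the inner projection from [P nabla]. *)
Lemma gproj_tangent Y u : M Y -> P Y (gproj ip g T Y u) = P Y u.
Proof.
move=> MY; apply: (gproj_ext hA MY (framedH MY)) => w Hw.
by rewrite (gproj_ip hA MY (tanF MY)) //; exact: HT.
Qed.

(** Differentiate the identity [P eta = eta] on [M]. *)
Lemma gproj_Dalong eta v Y : is_section M H eta -> M Y -> T Y v ->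
  P Y (Dalong M eta Y v) = Dalong M eta Y v - Dop M P Y v (eta Y).
Proof.
move=> [seta Heta] MY tv; have de := smooth_on_dif MY seta.
rewrite [in RHS](Dalong_eq MY (retM MY) tv (F' := fun Z => P Z (eta Z))) //.
  by rewrite (Dop_leibniz hA smooth_gproj) // addrC addKr.
by move=> Z MZ; rewrite (gproj_id hA MZ (framedH MZ)) //; exact: Heta.
Qed.

Lemma gproj_ambient_nabla X xi eta Y : vector_field M xi -> is_section M H eta ->
  M Y -> P Y (ambient_nabla ip M g X xi eta Y) =
  Dalong M eta Y (xi Y) + Gamma ip M g X H xi eta Y.
Proof.
move=> vxi Heta MY; rewrite /ambient_nabla gproj_tangent // /hat_nabla linearD /=.
by rewrite gproj_Dalong //; [rewrite /Gamma addrA|exact: vxi.2].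
Qed.

Variables (f : E -> R) (fhat : E -> E).
Hypotheses (smooth_f : smooth_on M f) (gradf : ambient_gradient ip M f fhat).
Let grad Z := P Z (ginv g Z (fhat Z)).

Lemma ambient_gradient_ip Y v : M Y -> T Y v -> ip v (fhat Y) = Dalong M f Y v.
Proof.
move=> MY tv; have [xi [vxi <-]] := extend_vector hA MY tv.
exact: gradf.2.
Qed.

(** Smoothness cannot come from the C^1 function [fhat]; its pairing with a local section [xi] of
    [H] is the derivative of [f] along [xi], which is smooth. *)
Lemma grad_section : is_section M H grad.
Proof.
split=> Y MY; last by exact: (gproj_in hA MY (framedH MY)).
apply: (gproj_ginv_smooth_at hA MY framedH) => U xi Z oU sxi Hxi UZ MZ.
apply: (smooth_at_eq oU UZ (F := fun z => Dalong M f z (xi z))).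
  by move=> z Uz Mz; rewrite ipC ambient_gradient_ip //; apply/HT/Hxi.
apply: (smooth_at_Dalong norm_ip MZ (retM MZ) oU UZ) => //; last exact: smooth_f.
by move=> z Uz Mz; apply/HT/Hxi.
Qed.

Lemma grad_ip Y v : M Y -> H Y v -> ip (grad Y) (g Y v) = ip (fhat Y) v.
Proof. by move=> MY Hv; rewrite (gproj_ginv_ip hA MY (framedH MY)). Qed.

Lemma rgradP : is_section M H (rgrad ip M g H f) /\
  forall Y, M Y -> rgrad ip M g H f Y = grad Y.
Proof.
have sg := grad_section.
have gg xi : is_section M H xi -> forall Y, M Y ->
    rmetric ip g Y (grad Y) (xi Y) = Dalong M f Y (xi Y).
  move=> [sxi Hxi] Y MY; rewrite /rmetric grad_ip //; last exact: Hxi.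
  by rewrite ipC ambient_gradient_ip //; exact/HT/Hxi.
rewrite /rgrad; case: xgetP => [G _ [sG GE]|/(_ grad)[]//].
split=> // Y MY; apply/eqP; rewrite -subr_eq0; apply/eqP/(metric_eq0 hA MY).
(* Both fields satisfy the gradient equation, and their difference is itself a section: testing with
   it gives [ip D (g D) = 0]. *)
pose D Z := G Z - grad Z.
have sD : is_section M H D.
  split=> Z MZ.
    by apply: (smooth_atB norm_ip MZ (retM MZ)); [exact: sG.1|exact: sg.1].
  by apply: (framedB MZ (framedH MZ)); [exact: sG.2|exact: sg.2].
have := GE D sD Y MY; have := gg D sD Y MY.
by rewrite /rmetric => gE; rewrite ipBl -/(D Y) gE => ->; rewrite subrr.
Qed.

Variable X : E -> E -> E -> E.
Hypothesis fX : ambient_form ip M g X.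
Variable nabla : (E -> E) -> (E -> E) -> E -> E.
Hypothesis lc : levi_civita ip M g nabla.

Lemma nablaE xi eta Y : vector_field M xi -> vector_field M eta -> M Y ->
  nabla xi eta Y = ambient_nabla ip M g X xi eta Y.
Proof.
exact: (levi_civita_unique hA lc (ambient_nabla_levi_civita hA fX)).
Qed.

Lemma nabla_rgrad xi Y : vector_field M xi -> M Y ->
  nabla xi (rgrad ip M g H f) Y = nabla xi grad Y.
Proof.
move=> vxi MY; have [cn _ _] := lc; have [sr rE] := rgradP.
by apply: (conn_ext cn) => //; apply: section_field => //; exact: grad_section.
Qed.

Lemma smooth_gproj_ginv u :
  smooth_on M (fun Z => (P Z \o ginv g Z)%VF u).
Proof.
move=> Y MY; apply: (smooth_at_eq openT I (F := fun Z => P Z (ginv g Z u))).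
  by move=> Z _ _; rewrite comp_lfunE.
apply: (smooth_at_gproj_ginv hA MY framedH); exact: (smooth_on_cst hA).
Qed.

Lemma rhess11E xi Y : is_section M H xi -> M Y ->
  rhess11 ip M g nabla H f xi Y = P Y (ginv g Y
    (ambient_hess M fhat xi Y
     + g Y (Dop M (fun Z => (P Z \o ginv g Z)%VF) Y (xi Y) (fhat Y))
     + Kform M g X xi grad Y)).
Proof.
move=> sxi MY; have vxi := section_field sxi; have tx := vxi.2 Y MY.
have vg := section_field grad_section.
rewrite /rhess11 nabla_rgrad // nablaE // /ambient_nabla gproj_tangent // /hat_nabla.
rewrite !(linearD (ginv g Y)) /= (ginvK hA) //.
rewrite (Dalong_eq MY (retM MY) tx
  (F' := fun Z => (P Z \o ginv g Z)%VF (fhat Z))); last 2 first.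
- exact: smooth_on_dif MY grad_section.1.
- by move=> Z _; rewrite comp_lfunE.
rewrite (Dop_leibniz hA smooth_gproj_ginv _ MY tx); last exact: (C1_dif MY (proj1 gradf)).
(* The Leibniz term [P g^-1 (D fhat)] already lies in [H], so the outer projection fixes it. *)
rewrite comp_lfunE !(linearD (P Y)); congr (_ + _); rewrite addrC; congr (_ + _).
exact: (gproj_id hA MY (framedH MY) (gproj_in hA MY (framedH MY) _)).
Qed.

Lemma smooth_ginv u : smooth_on M (fun Z => ginv g Z u).
Proof. by apply: (ginv_smooth hA); exact: (smooth_on_cst hA). Qed.

(** Differentiate [g (g^-1 u) = u] with [u] constant. *)
Lemma Dop_ginv Y v u : M Y -> T Y v ->
  Dop M (ginv g) Y v u = - ginv g Y (Dop M g Y v (ginv g Y u)).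
Proof.
move=> MY tv; have := Dalong_cst MY (retM MY) tv u.
have du := smooth_on_dif MY (smooth_ginv u).
rewrite (Dalong_eq MY (retM MY) tv (F' := fun Z => g Z (ginv g Z u))); first last.
- by move=> Z MZ; rewrite (gK hA).
- exact: smooth_on_dif MY (smooth_on_cst hA u).
rewrite (Dop_leibniz hA smooth_g du MY tv) => /eqP.
rewrite addrC addr_eq0 => /eqP/(congr1 (ginv g Y)).
by rewrite (ginvK hA) // linearN.
Qed.

Lemma Dop_gproj_ginv Y v u : M Y -> T Y v ->
  Dop M (fun Z => (P Z \o ginv g Z)%VF) Y v u =
  Dop M P Y v (ginv g Y u) - P Y (ginv g Y (Dop M g Y v (ginv g Y u))).
Proof.
move=> MY tv; have du := smooth_on_dif MY (smooth_ginv u).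
rewrite /Dop (Dalong_eq MY (retM MY) tv (F' := fun Z => P Z (ginv g Z u))); first last.
- by move=> Z _; rewrite comp_lfunE.
- exact: smooth_on_dif MY (smooth_gproj_ginv u).
rewrite (Dop_leibniz hA smooth_gproj du MY tv).
by rewrite -[Dalong M (fun Z => ginv g Z u) Y v]/(Dop M (ginv g) Y v u) Dop_ginv // linearN.
Qed.

Lemma rhess11E' xi Y : is_section M H xi -> M Y ->
  rhess11 ip M g nabla H f xi Y = P Y (ginv g Y
    (ambient_hess M fhat xi Y
     + g Y (Dop M P Y (xi Y) (ginv g Y (fhat Y)))
     - Dop M g Y (xi Y) (ginv g Y (fhat Y))
     + Kform M g X xi grad Y)).
Proof.
move=> sxi MY; have tx := (section_field sxi).2 Y MY.
rewrite rhess11E // Dop_gproj_ginv // -[in RHS](addrA (ambient_hess _ _ _ _)).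
rewrite !(linearD (ginv g Y), linearN (ginv g Y)) (linearB (g Y)) (linearB (ginv g Y)).
rewrite !(linearD (P Y), linearN (P Y)) /=; congr (_ + _ + _).
rewrite !(ginvK hA) //; congr (_ - _).
exact: (gproj_id hA MY (framedH MY) (gproj_in hA MY (framedH MY) _)).
Qed.

Lemma rhess02E xi eta Y : is_section M H xi -> is_section M H eta -> M Y ->
  rhess02 ip M g nabla H f xi eta Y =
  ip (ambient_hess M fhat xi Y) (eta Y) - ip (Gamma ip M g X H xi eta Y) (fhat Y).
Proof.
move=> sxi seta MY; have vxi := section_field sxi; have veta := section_field seta.
have tx := vxi.2 Y MY; have sg := grad_section; have vg := section_field sg.
rewrite /rhess02 nabla_rgrad //; have [_ _ mn] := lc; have rY := retM MY.
have := mn xi grad eta vxi vg veta Y MY.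
have dh := C1_dif MY (proj1 gradf); have de := smooth_on_dif MY seta.1.
rewrite (Dalong_eq MY rY tx (F' := fun Z => ip (fhat Z) (eta Z) : R)); first last.
- by move=> Z MZ; rewrite /rmetric grad_ip //; exact: seta.2.
- apply: (smooth_on_dif MY); apply: (smooth_on_ip hA); first exact: sg.1.
  by apply: (smooth_on_app hA) => //; exact: seta.1.
rewrite (Dalong_ip norm_ip MY rY tx dh de).
(* Since [grad] lies in [H], its pairing with nabla sees only the [H]-projection, which is
   [D_xi eta + Gamma_H]; the [D_xi eta] part cancels against the product rule for [ip fhat eta]. *)
have Hg : rmetric ip g Y (grad Y) (nabla xi eta Y) =
    ip (fhat Y) (Dalong M eta Y (xi Y)) + ip (fhat Y) (Gamma ip M g X H xi eta Y).
  rewrite -ipDr -gproj_ambient_nabla // -nablaE // -grad_ip //; last first.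
    exact: (gproj_in hA MY (framedH MY)).
  have gC u v : ip u (g Y v) = ip v (g Y u) by rewrite -(g_sym MY) ipC.
  by rewrite /rmetric gC [RHS]gC (gproj_ip hA MY (framedH MY)) //; exact: sg.2.
rewrite Hg /ambient_hess [ip (Gamma _ _ _ _ _ _ _ _) _]ipC => mE.
by apply/eqP; rewrite eq_sym subr_eq -(inj_eq (addIr (ip (fhat Y) (Dalong M eta Y (xi Y))))) mE
  addrAC addrA.
Qed.

End Subbundle.

End Hessian.

Theorem theorem1 (R : realType) (E : normedVectType R)
    (ip : {dot E for idfun}) (d : nat) (M : set E) (g : E -> 'End(E))
    (hA : ambient_structure ip d M g) :
  (* (1) *)
  ((exists X : E -> E -> E -> E,
      [/\ ambient_form ip M g X, tangent_valued M X &
          forall xi eta, vector_field M xi -> vector_field M eta ->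
            smooth_on M (fun Y => X Y (xi Y) (eta Y))]) /\
   (forall X1 X2 : E -> E -> E -> E,
      ambient_form ip M g X1 -> ambient_form ip M g X2 ->
      forall xi eta, vector_field M xi -> vector_field M eta ->
      forall Y, M Y ->
        gproj ip g (tangent M) Y (ginv g Y (X1 Y (xi Y) (eta Y))) =
        gproj ip g (tangent M) Y (ginv g Y (X2 Y (xi Y) (eta Y)))) /\
   (forall X1 X2 : E -> E -> E -> E,
      ambient_form ip M g X1 -> ambient_form ip M g X2 ->
      tangent_valued M X1 -> tangent_valued M X2 ->
      forall xi eta, vector_field M xi -> vector_field M eta ->
      forall Y, M Y -> X1 Y (xi Y) (eta Y) = X2 Y (xi Y) (eta Y))) /\
  (forall X : E -> E -> E -> E, ambient_form ip M g X ->
   (* (2) *)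
   (levi_civita ip M g (ambient_nabla ip M g X) /\
    (forall nabla : (E -> E) -> (E -> E) -> E -> E,
      levi_civita ip M g nabla ->
      forall xi eta, vector_field M xi -> vector_field M eta ->
      forall Y, M Y -> nabla xi eta Y = ambient_nabla ip M g X xi eta Y) /\
    (forall xi eta, vector_field M xi -> vector_field M eta ->
     forall Y, M Y ->
       ambient_nabla ip M g X xi eta Y =
       Dalong M eta Y (xi Y) + Gamma ip M g X (tangent M) xi eta Y)) /\
   (forall nabla : (E -> E) -> (E -> E) -> E -> E,
    levi_civita ip M g nabla ->
    forall H : E -> set E, subbundle M H ->
    (* (3) *)
    (forall xi eta, is_section M H xi -> is_section M H eta ->
     forall Y, M Y ->
       gproj ip g H Y (nabla xi eta Y) =
       Dalong M eta Y (xi Y) + Gamma ip M g X H xi eta Y) /\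
    (* (4) *)
    (forall (f : E -> R) (fhat : E -> E),
     smooth_on M f -> ambient_gradient ip M f fhat ->
     let grad := fun Z => gproj ip g H Z (ginv g Z (fhat Z)) in
     forall xi eta, is_section M H xi -> is_section M H eta ->
     forall Y, M Y ->
       [/\ rhess11 ip M g nabla H f xi Y =
             gproj ip g H Y (ginv g Y
               (ambient_hess M fhat xi Y
                + g Y (Dop M (fun Z => (gproj ip g H Z \o ginv g Z)%VF)
                         Y (xi Y) (fhat Y))
                + Kform M g X xi grad Y)),
           rhess11 ip M g nabla H f xi Y =
             gproj ip g H Y (ginv g Y
               (ambient_hess M fhat xi Y
                + g Y (Dop M (gproj ip g H) Y (xi Y) (ginv g Y (fhat Y)))
                - Dop M g Y (xi Y) (ginv g Y (fhat Y))
                + Kform M g X xi grad Y)),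
           rhess02 ip M g nabla H f xi eta Y =
             ip (nabla xi grad Y) (g Y (eta Y)) &
           rhess02 ip M g nabla H f xi eta Y =
             ip (ambient_hess M fhat xi Y) (eta Y)
             - ip (Gamma ip M g X H xi eta Y) (fhat Y)]))).
Proof.
have tanF := tangent_framed hA; have smooth_g := ambient_smooth hA.
split.
  split; first exact: ambient_form_exists hA.
  split=> [X1 X2 f1 f2 xi eta vxi veta Y MY|X1 X2 f1 f2 t1 t2 xi eta vxi veta Y MY].
    apply: (gproj_ginv_ext hA MY (tanF Y MY)) => w tw.
    have [tx te] := (vxi.2 Y MY, veta.2 Y MY).
    by rewrite (ambient_form_ip hA f1) // (ambient_form_ip hA f2).
  have [tx te] := (vxi.2 Y MY, veta.2 Y MY).
  apply/eqP; rewrite -subr_eq0; apply/eqP/(ip_eq0 (ip := ip)).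
  have tt : tangent M Y (X1 Y (xi Y) (eta Y) - X2 Y (xi Y) (eta Y)).
    by apply: (tangentB hA MY); [exact: t1|exact: t2].
  by rewrite ipBl (ambient_form_ip hA f1) // (ambient_form_ip hA f2) // subrr.
move=> X fX; have lcX := ambient_nabla_levi_civita hA fX; split.
  split=> //; split=> [nabla lc xi eta vxi veta Y MY|xi eta vxi veta Y MY].
    exact: (levi_civita_unique hA lc lcX).
  (* The formula for nabla is the case [H = TM] of the subbundle formula, because the tangent
     projection fixes nabla. *)
  rewrite -(gproj_ambient_nabla hA tanF (fun _ _ _ tu => tu)) //.
  by rewrite (gproj_id hA MY (tanF Y MY)) //; exact: (ambient_nabla_tangent hA).
move=> nabla lc H sH; have HT := sH.1.
have framedH Y : M Y -> framed_at M H Y by exact: subbundle_framed.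
split=> [xi eta sxi seta Y MY|f fhat sf gf grad xi eta sxi seta Y MY].
  have vxi := section_field HT sxi; have veta := section_field HT seta.
  by rewrite (nablaE hA fX lc) // (gproj_ambient_nabla hA framedH HT).
split.
- exact: (rhess11E hA framedH HT sf gf fX lc).
- exact: (rhess11E' hA framedH HT sf gf fX lc).
- rewrite /rhess02 (nabla_rgrad hA framedH HT sf gf lc) //.
  exact: (section_field HT sxi).
- exact: (rhess02E hA framedH HT sf gf fX lc).
Qed.
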